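(* There exists a constant $D > 1$ such that the following holds. Let $G = (U, V, E)$ be a bipartite graph with $|U| = |V| = n \geq 3$, let $k$ be a real number with $k \geq n \cdot \frac{D \cdot \log\log n}{\log n}$, and let $t = n/k$. Suppose that vectors $e \in \mathbb{R}^d$ and $u_i \in \mathbb{R}^d$ $(i \in U \cup V)$ form a feasible solution, with this value of $k$, to the MBB SDP relaxation for $G$, i.e. they satisfy all of the following constraints: \begin{align*} & \|e\|^2 = 1, \\ & \|u_i\|^2 = \langle u_i, e \rangle && \forall i \in U \cup V, \\ & \sum_{i \in U} \langle u_i, e \rangle = \sum_{j \in V} \langle u_j, e \rangle = k, \\ & \langle u_i, u_j \rangle = 0 && \forall (i,j) \in (U \times V) \setminus E, \\ & \langle u_i, u_j \rangle \geq 0 && \forall (i,j) \in U \times V, \\ & \sum_{j \in V} \langle u_i, u_j \rangle = k \langle u_i, e \rangle && \forall i \in U, \\ & \sum_{i \in U} \langle u_i, u_j \rangle = k \langle u_j, e \rangle && \forall j \in V. \end{align*} Then there is an efficient (randomized polynomial-time) rounding algorithm that, given $G$ and such a feasible solution, finds with high probability a balanced biclique in $G$ of size at least $n^{\frac{1}{D \cdot t}}$. (The algorithm is a single one that works for all such inputs.)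
   Context: $\log$ denotes the natural logarithm. For a bipartite graph $G = (U, V, E)$ with disjoint sides $U, V$ and $E \subseteq U \times V$, a balanced biclique of size $s$ is a pair $S \subseteq U$, $T \subseteq V$ with $|S| = |T| = s$ and $S \times T \subseteq E$. $\langle \cdot, \cdot \rangle$ and $\|\cdot\|$ are the Euclidean inner product and norm on $\mathbb{R}^d$. ''With high probability'' means with probability $1 - o(1)$ as $n \to \infty$ over the algorithm's internal randomness, where $o(1)$ depends only on $n$. The running time is polynomial in $n$ and $d$, where arithmetic on the real coordinates of the vectors and sampling from a standard Gaussian distribution are treated as elementary operations. *)

(* Defs.v *)
From HB Require Import structures.
From mathcomp Require Import all_boot all_order all_algebra.
From mathcomp Require Import all_classical all_reals all_analysis.

Set Implicit Arguments.
Unset Strict Implicit.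
Unset Printing Implicit Defensive.

Import Order.TTheory GRing.Theory Num.Theory.
Import numFieldNormedType.Exports.

Local Open Scope ring_scope.

(** * Bicliques and the SDP relaxation *)

Section Mbb.
Context (R : realType) (U V : finType).
Implicit Type E : {set U * V}.

Definition balanced_biclique E (S : {set U}) (T : {set V}) : Prop :=
  #|S| = #|T| /\ forall i j, i \in S -> j \in T -> (i, j) \in E.

Definition inner d (x y : 'rV[R]_d) : R := \sum_(c < d) x 0 c * y 0 c.

(** The norm [`|x|] on ['rV[R]_d] is the supremum norm, hence this one. *)
Definition enorm d (x : 'rV[R]_d) : R := Num.sqrt (inner x x).

(** [u] and [v] are the vectors attached to the vertices of [U] and of [V]. *)
Record mbb_sdp_feasible E (k : R) d (e : 'rV[R]_d)
    (u : U -> 'rV[R]_d) (v : V -> 'rV[R]_d) : Prop := MbbSdpFeasible {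
  sdp_unit : enorm e ^+ 2 = 1 ;
  sdp_normU : forall i, enorm (u i) ^+ 2 = inner (u i) e ;
  sdp_normV : forall j, enorm (v j) ^+ 2 = inner (v j) e ;
  sdp_sizeU : \sum_i inner (u i) e = k ;
  sdp_sizeV : \sum_j inner (v j) e = k ;
  sdp_nonedge : forall i j, (i, j) \notin E -> inner (u i) (v j) = 0 ;
  sdp_ge0 : forall i j, 0 <= inner (u i) (v j) ;
  sdp_degU : forall i, \sum_j inner (u i) (v j) = k * inner (u i) e ;
  sdp_degV : forall j, \sum_i inner (u i) (v j) = k * inner (v j) e }.

End Mbb.

(** * Randomized real RAM

    Programs are finite pieces of syntax, independent of the input and of the
    model of the reals. They act on two memories, one of naturals and one of
    reals, both made of arrays: [a, i, j] addresses the cell [(i, j)] of the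
    array named [a].

    The reals are exact. They support field operations and comparison (no
    rounding to an integer), and the only constants are images of naturals.
    The naturals, which serve as indices and counters, have addition and
    truncated subtraction but no multiplication, so that each step
    adds only a bounded number of bits to the naturals met so far. *)

Inductive nexp : Type :=
| NConst of nat
| NGet of nat & nexp & nexp
| NAdd of nexp & nexp
| NSub of nexp & nexp.

Inductive rexp : Type :=
| RNat of nexp
| RGet of nat & nexp & nexp
| RAdd of rexp & rexp
| RSub of rexp & rexp
| RMul of rexp & rexp
| RDiv of rexp & rexp.

Inductive bexp : Type :=
| BNle of nexp & nexp
| BRle of rexp & rexp
| BNot of bexp
| BAnd of bexp & bexp.

(** [NSet a i j x] and [RSet a i j x] assign [x] to a cell; [Gauss a i j]
    assigns a fresh standard Gaussian sample to a cell of the real memory. *)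
Inductive cmd : Type :=
| Skip
| NSet of nat & nexp & nexp & nexp
| RSet of nat & nexp & nexp & rexp
| Gauss of nat & nexp & nexp
| Seq of cmd & cmd
| If of bexp & cmd & cmd
| While of bexp & cmd.

Section Semantics.
Context (R : realType).

Record memory := Memory {
  nmem : nat -> nat -> nat -> nat ;
  rmem : nat -> nat -> nat -> R }.

Definition upd X (f : nat -> nat -> nat -> X) a i j (x : X) :=
  fun a' i' j' => if [&& a' == a, i' == i & j' == j] then x else f a' i' j'.

Definition nupd m a i j x := Memory (upd (nmem m) a i j x) (rmem m).
Definition rupd m a i j x := Memory (nmem m) (upd (rmem m) a i j x).

Fixpoint neval (m : memory) (x : nexp) : nat :=
  match x with
  | NConst c => c
  | NGet a i j => nmem m a (neval m i) (neval m j)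
  | NAdd y z => (neval m y + neval m z)%N
  | NSub y z => (neval m y - neval m z)%N
  end.

Fixpoint reval (m : memory) (x : rexp) : R :=
  match x with
  | RNat y => (neval m y)%:R
  | RGet a i j => rmem m a (neval m i) (neval m j)
  | RAdd y z => reval m y + reval m z
  | RSub y z => reval m y - reval m z
  | RMul y z => reval m y * reval m z
  | RDiv y z => reval m y / reval m z
  end.

Fixpoint beval (m : memory) (b : bexp) : bool :=
  match b with
  | BNle x y => (neval m x <= neval m y)%N
  | BRle x y => reval m x <= reval m y
  | BNot c => ~~ beval m c
  | BAnd c c' => beval m c && beval m c'
  end.

(** [todo] is the stack of commands still to be run and [drawn] the number of
    Gaussian samples drawn so far. *)
Record config := Config {
  todo : seq cmd ;
  store : memory ;
  drawn : nat }.

(** One step of the machine, where [g s] is the [s]-th Gaussian sample. Each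
    step performs at most one command or test of the program, hence a number
    of elementary operations bounded in terms of the program only. *)
Definition step (g : nat -> R) (c : config) : config :=
  let: Config k m s := c in
  match k with
  | [::] => c
  | Skip :: k' => Config k' m s
  | NSet a i j x :: k' =>
      Config k' (nupd m a (neval m i) (neval m j) (neval m x)) s
  | RSet a i j x :: k' =>
      Config k' (rupd m a (neval m i) (neval m j) (reval m x)) s
  | Gauss a i j :: k' =>
      Config k' (rupd m a (neval m i) (neval m j) (g s)) s.+1
  | Seq p q :: k' => Config [:: p, q & k'] m s
  | If b p q :: k' => Config ((if beval m b then p else q) :: k') m s
  | While b p :: k' =>
      Config (if beval m b then [:: p, While b p & k'] else k') m s
  end.

Definition run (p : cmd) (g : nat -> R) (m : memory) (T : nat) : config :=
  iter T (step g) (Config [:: p] m 0).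

Definition halted (c : config) : bool := nilp (todo c).

End Semantics.

(** * Inputs and outputs *)

Section InputOutput.
Context (R : realType).

Definition table X (x0 : X) n m (f : 'I_n -> 'I_m -> X) (i j : nat) : X :=
  if (insub i : option 'I_n) is Some i' then
    if (insub j : option 'I_m) is Some j' then f i' j' else x0
  else x0.

(** Natural memory: [n] and [d] in the cell [(0, 0)] of arrays 0 and 1, the
    adjacency matrix in array 2. Real memory: [e] in row 0 of array 0, the
    [u i] and the [v j] in the rows of arrays 1 and 2. Every other cell,
    including the output arrays, is 0. *)
Definition input n d (E : {set 'I_n * 'I_n}) (e : 'rV[R]_d)
    (u v : 'I_n -> 'rV[R]_d) : memory R :=
  Memory
    (fun a i j => match a with
     | 0 => if (i == 0) && (j == 0) then n else 0
     | 1 => if (i == 0) && (j == 0) then d else 0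
     | 2 => table 0 (fun i' j' : 'I_n => nat_of_bool ((i', j') \in E)) i j
     | _ => 0
     end%N)
    (fun a i j => match a with
     | 0%N => table 0 (fun (_ : 'I_1) c => e 0 c) i j
     | 1%N => table 0 (fun i' c => u i' 0 c) i j
     | 2%N => table 0 (fun j' c => v j' 0 c) i j
     | _ => 0
     end).

(** The output is a subset of either side, given by the nonzero entries of
    row 0 of the natural arrays 3 and 4. *)
Definition outputU n (m : memory R) : {set 'I_n} :=
  [set i : 'I_n | nmem m 3 0 i != 0%N].
Definition outputV n (m : memory R) : {set 'I_n} :=
  [set j : 'I_n | nmem m 4 0 j != 0%N].

Definition time_bound (C n d : nat) : nat := (C * (n + d).+1 ^ C)%N.

(** Worst case: the bound holds on every input and for every sequence of
    values of the Gaussian samples. *)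
Definition runs_in_time (p : cmd) (C : nat) : Prop :=
  forall n d E (e : 'rV[R]_d) (u v : 'I_n -> 'rV[R]_d) (g : nat -> R),
    halted (run p g (input E e u v) (time_bound C n d)).

End InputOutput.

(** * Independent Gaussian samples *)

Section Iid.
Context (R : realType) (dT : measure_display) (X : measurableType dT).

Definition tcons N (z : X * N.-tuple X) : N.+1.-tuple X := [tuple of z.1 :: z.2].

Lemma measurable_tcons N : measurable_fun setT (@tcons N).
Proof. exact: measurable_cons measurable_fst measurable_snd. Qed.

HB.instance Definition _ N :=
  isMeasurableFun.Build _ _ _ _ (@tcons N) (@measurable_tcons N).

(** The product of [N] copies of [P]: the law of [N] independent samples. *)
Fixpoint iid (P : probability X R) (N : nat) : probability (N.-tuple X) R :=
  match N with
  | 0 => \d_([tuple] : 0.-tuple X)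
  | N'.+1 => distribution (P \x iid P N')%E (@tcons N')
  end.

End Iid.

(** The run of [p] for [T] steps, on [T] standard Gaussian samples; this is
    enough, since a step draws at most one sample. *)
Definition gauss_run (R : realType) (p : cmd) (m : memory R) (T : nat)
    (g : T.-tuple (measurableTypeR R)) : memory R :=
  store (run p (fun s => nth 0 g s) m T).

Definition gauss_law (R : realType) (T : nat) :
    probability (T.-tuple (measurableTypeR R)) R :=
  iid (normal_prob (0 : R) 1) T.

(* Main.v *)
Require Import Defs.
From mathcomp Require Import all_boot all_order all_algebra.
From mathcomp Require Import all_classical all_reals all_analysis.
From mathcomp Require Import zify ring lra.
Import Order.TTheory GRing.Theory Num.Theory.
Import numFieldNormedType.Exports.

(** Gaussian rounding is derandomized. Put [a i = <u_i, e>], [b j = <v_j, e>],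
    [x_i = u_i / a i - e] and [y_j = v_j / b j - e]. Then [<x_i, y_j> >= -1],
    with equality on the non-edges, while the degree constraints make the
    average of [<x_i, y_j>] for the weights [a i * b j] vanish. Vertices with
    [a i < k / (4 n)] are dropped; they carry little weight, and for the others
    [|x_i|^2 <= r = 4 n / k].

    A random walk multiplies, at each step, the weights [p i] by
    [1 + s * x_i c] and [q j] by [1 + s * y_j c] for a random coordinate [c] and
    a random sign of [s]. In expectation [p i * q j] is multiplied by
    [1 + eps * <x_i, y_j>], where [eps = s ^ 2 / d]. After [n * d] steps this
    makes the non-edges lighter than the average pair by a factor [K] that is a
    power [n ^ (c k / n)], while the sums of squares of the weights grow by a
    small power of [n] only. The method of conditional expectations replaces
    the random choice: one keeps the conditional expectation of
      [(\sum p) (\sum q) - K \sum_(non-edges) p q - L (\sum p^2 + \sum q^2)]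
    positive. At the end the weights are spread out and the non-edges have
    density less than [1 / K]. Greedily collecting vertices [i] whose
    non-neighbours have [q]-density at most [2 / K], as long as enough common
    neighbours remain, produces the biclique. *)

Set Implicit Arguments.
Unset Strict Implicit.
Unset Printing Implicit Defensive.

Local Open Scope ring_scope.

(** * A loop language and its compilation *)

(** The step size balances two demands. Over [n * d] steps the product [eps * n * d = s ^ 2 * n] is
    taken of order [k log n / n]. Then [K] grows to a power [n ^ (c k / n)], which is the scale of
    the target, while the sums of squares grow by at most [exp (O (eps n d * n / k))], a fixed power
    of [n] that the factor 1/128 makes small. A single step must also satisfy [s ^ 2 * r <= 1], so
    that no weight turns negative; one round of [d] steps would violate this by a factor [log n],
    hence the [n] rounds.

    The lower bound on [k] says that the target [n ^ (1 / (D t))] is at least [log n]. Powers of the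
    target thus absorb all numerical constants, and small [n] disappear because [k <= n].

    A walk along coordinates has only [2 d] moves at each step, so the conditional expectations are
    finite sums that exact real arithmetic evaluates and compares with 0. The machine has no
    logarithm or root: the harmonic number replaces [log n] and an integer search replaces the root.
    [D] does not occur in the program, so the greedy extraction works without knowing the size it
    has to reach. *)

Inductive lim : Type := Ln | Ld.

(** With bounded loops only, the running time can be read off the syntax; without a sampling
    command, the runs are deterministic. *)
Inductive prog : Type :=
| Nop
| PN of nat & nexp & nexp & nexp
| PR of nat & nexp & nexp & rexp
| Sq of prog & prog
| Cond of bexp & prog & prog
| For of nat & lim & prog.

Definition limv (l : lim) (n d : nat) : nat := if l is Ln then n else d.

Definition cell (a : nat) : nexp := NGet a (NConst 0) (NConst 0).

(** [limv l 0 1] is the name of the array whose first cell holds the bound: 0 for [n], 1 for [d]. *)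
Fixpoint compile (p : prog) : cmd :=
  match p with
  | Nop => Skip
  | PN a i j x => NSet a i j x
  | PR a i j x => RSet a i j x
  | Sq p q => Seq (compile p) (compile q)
  | Cond b p q => If b (compile p) (compile q)
  | For a l p =>
      Seq (NSet a (NConst 0) (NConst 0) (NConst 0))
          (While (BNle (NAdd (cell a) (NConst 1)) (cell (limv l 0 1)))
            (Seq (compile p)
              (NSet a (NConst 0) (NConst 0) (NAdd (cell a) (NConst 1)))))
  end.

Fixpoint nwrites (p : prog) : seq nat :=
  match p with
  | PN a _ _ _ => [:: a]
  | Sq p q | Cond _ p q => nwrites p ++ nwrites q
  | For a _ p => a :: nwrites p
  | _ => [::]
  end.

Fixpoint rwrites (p : prog) : seq nat :=
  match p with
  | PR a _ _ _ => [:: a]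
  | Sq p q | Cond _ p q => rwrites p ++ rwrites q
  | For _ _ p => rwrites p
  | _ => [::]
  end.

(* The bounds of the loops sit in the arrays 0 and 1. *)
Fixpoint wf (p : prog) : bool :=
  match p with
  | PN a _ _ _ => (1 < a)%N
  | Sq p q | Cond _ p q => wf p && wf q
  | For a _ p => [&& (1 < a)%N, a \notin nwrites p & wf p]
  | _ => true
  end.

(** Each turn of a loop adds the test, the unfolding of a [Seq] and the increment; outside the turns
    there are a [Seq], the reset of the counter and the failing test. *)
Fixpoint cost (n d : nat) (p : prog) : nat :=
  match p with
  | Sq p q | Cond _ p q => (cost n d p + cost n d q).+1
  | For _ l p => (limv l n d * (cost n d p + 3) + 3)%N
  | _ => 1
  end.

Section Sem.
Context (R : realType).
Implicit Types (m : memory R) (p q : prog).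

Definition bound l m : nat := limv l (nmem m 0 0 0) (nmem m 1 0 0).

Definition incr a m := nupd m a 0 0 (nmem m a 0 0).+1.

Fixpoint sem p m : memory R :=
  match p with
  | Nop => m
  | PN a i j x => nupd m a (neval m i) (neval m j) (neval m x)
  | PR a i j x => rupd m a (neval m i) (neval m j) (reval m x)
  | Sq p q => sem q (sem p m)
  | Cond b p q => if beval m b then sem p m else sem q m
  | For a l p =>
      iter (bound l m) (fun m' => incr a (sem p m')) (nupd m a 0 0 0)
  end.

(** Whole arrays are tracked rather than cells, so that non-interference of two pieces of program
    reduces to membership in literal lists of names. *)
Definition agree (nl rl : seq nat) m m' :=
  (forall a i j, a \notin nl -> nmem m' a i j = nmem m a i j) /\
  (forall a i j, a \notin rl -> rmem m' a i j = rmem m a i j).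

Lemma upd_other X (f : nat -> nat -> nat -> X) a i j x a' i' j' :
  a' != a -> upd f a i j x a' i' j' = f a' i' j'.
Proof. by rewrite /upd => /negPf ->. Qed.

Lemma agree_trans nl rl m1 m2 m3 :
  agree nl rl m1 m2 -> agree nl rl m2 m3 -> agree nl rl m1 m3.
Proof.
by move=> [n1 r1] [n2 r2]; split=> a i j ha; rewrite ?n2 ?n1 ?r2 ?r1.
Qed.

Lemma agree_refl nl rl m : agree nl rl m m.
Proof. by []. Qed.

Lemma agree_sub nl rl nl' rl' m m' :
  {subset nl <= nl'} -> {subset rl <= rl'} -> agree nl rl m m' ->
  agree nl' rl' m m'.
Proof.
move=> sn sr [hn hr]; split=> a i j ha.
  by apply: hn; apply: contra ha; apply: sn.
by apply: hr; apply: contra ha; apply: sr.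
Qed.

Lemma agree_nupd nl rl m a i j x : a \in nl -> agree nl rl m (nupd m a i j x).
Proof.
move=> ha; split=> a' i' j' // ha' /=; rewrite upd_other //.
by apply: contraNneq ha' => ->.
Qed.

Lemma agree_rupd nl rl m a i j x : a \in rl -> agree nl rl m (rupd m a i j x).
Proof.
move=> ha; split=> a' i' j' // ha' /=; rewrite upd_other //.
by apply: contraNneq ha' => ->.
Qed.

Lemma frame p m : agree (nwrites p) (rwrites p) m (sem p m).
Proof.
elim: p m => [|a i j x|a i j x|p IHp q IHq|b p IHp q IHq|a l p IHp] m //=.
- by apply: agree_nupd; rewrite inE.
- by apply: agree_rupd; rewrite inE.
- apply: (@agree_trans _ _ _ (sem p m)).
    by apply: (agree_sub _ _ (IHp m)) => c hc; rewrite mem_cat hc.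
  by apply: (agree_sub _ _ (IHq _)) => c hc; rewrite mem_cat hc orbT.
- case: (beval m b).
    by apply: (agree_sub _ _ (IHp m)) => c hc; rewrite mem_cat hc.
  by apply: (agree_sub _ _ (IHq _)) => c hc; rewrite mem_cat hc orbT.
- have: agree (a :: nwrites p) (rwrites p) m (nupd m a 0 0 0).
    by apply: agree_nupd; rewrite inE eqxx.
  elim: (bound l m) => [//|N IH] /IH h /=.
  apply: (agree_trans h); apply: (agree_trans _ (agree_nupd _ _ _ _ _ _)).
    by apply: (agree_sub _ _ (IHp _)) => // c hc; rewrite inE hc orbT.
  by rewrite inE eqxx.
Qed.

(** The compiled loop reads its bound again at each test; this is why the bound cannot have
    changed. *)
Lemma wf_nwrites p a : wf p -> (a < 2)%N -> a \notin nwrites p.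
Proof.
move=> + ha; elim: p => [|b i j x|b i j x|p IHp q IHq|b p IHp q IHq|b l p IHp] //=.
- by rewrite inE => hb; lia.
- by case/andP=> /IHp hp /IHq hq; rewrite mem_cat negb_or hp.
- by case/andP=> /IHp hp /IHq hq; rewrite mem_cat negb_or hp.
- by case/and3P=> hb _ /IHp hp; rewrite inE negb_or hp andbT; lia.
Qed.

(* The step may use that the state has only been changed by the body. *)
Lemma for_inv (I : nat -> memory R -> Prop) a l p m :
  wf (For a l p) ->
  I 0%N (nupd m a 0 0 0) ->
  (forall i m', (i < bound l m)%N -> agree (a :: nwrites p) (rwrites p) m m' ->
     nmem m' a 0 0 = i -> I i m' -> I i.+1 (incr a (sem p m'))) ->
  I (bound l m) (sem (For a l p) m).
Proof.
move=> /= /and3P[ha hap wp] I0 IS.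
suff: forall N, (N <= bound l m)%N ->
  let m' := iter N (fun m' => incr a (sem p m')) (nupd m a 0 0 0) in
  [/\ agree (a :: nwrites p) (rwrites p) m m', nmem m' a 0 0 = N & I N m'].
  by move=> /(_ _ (leqnn _)) [].
elim=> [_|N IH hN] /=.
  split=> //; first by apply: agree_nupd; rewrite inE eqxx.
  by rewrite /upd !eqxx.
have [h1 h2 h3] := IH (ltnW hN); split.
- apply: (agree_trans h1); apply: (agree_trans _ (agree_nupd _ _ _ _ _ _)).
    by apply: (agree_sub _ _ (frame p _)) => // c hc; rewrite inE hc orbT.
  by rewrite inE eqxx.
- by rewrite /upd !eqxx /= (proj1 (frame p _)) // h2.
- exact: IS.
Qed.

(** * Simulation by the machine and polynomial running time *)

Section Exec.
Variable g : nat -> R.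

Lemma iterD_config N1 N2 (c1 c2 c3 : config R) :
  iter N1 (step g) c1 = c2 -> iter N2 (step g) c2 = c3 ->
  iter (N1 + N2) (step g) c1 = c3.
Proof. by move=> <- <-; rewrite addnC iterD. Qed.

Lemma exec p m k s : wf p ->
  exists2 N, (N <= cost (nmem m 0 0 0) (nmem m 1 0 0) p)%N &
    iter N (step g) (Config (compile p :: k) m s) = Config k (sem p m) s.
Proof.
elim: p m k => [|a i j x|a i j x|p IHp q IHq|b p IHp q IHq|a l p IHp] m k.
- by exists 1%N.
- by exists 1%N.
- by exists 1%N.
- case/andP=> wp wq.
  have [N1 h1 e1] := IHp m (compile q :: k) wp.
  have [N2 h2 e2] := IHq (sem p m) k wq.
  have [fr _] := frame p m.
  move: h2; rewrite !fr ?wf_nwrites // => h2.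
  exists (N1 + N2).+1; first by rewrite /= ltnS leq_add.
  by rewrite iterSr /=; apply: (iterD_config e1 e2).
- case/andP=> wp wq; rewrite /=; case hb: (beval m b).
    have [N1 h1 e1] := IHp m k wp.
    exists N1.+1; first by rewrite ltnS (leq_trans h1) // leq_addr.
    by rewrite iterSr /= hb.
  have [N1 h1 e1] := IHq m k wq.
  exists N1.+1; first by rewrite ltnS (leq_trans h1) // leq_addl.
  by rewrite iterSr /= hb.
- rewrite /= => /and3P[ha hap wp].
  set w := While _ _.
  pose F m' := incr a (sem p m').
  pose n := nmem m 0 0 0; pose d := nmem m 1 0 0.
  (* Induction on the number [N] of remaining turns, for any memory whose counter is [N] below the
     bound. *)
  have key N m' : nmem m' 0%N 0%N 0%N = n -> nmem m' 1%N 0%N 0%N = d ->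
      (nmem m' a 0 0 + N = bound l m)%N ->
      exists2 N', (N' <= N * (cost n d p + 3) + 1)%N &
      iter N' (step g) (Config (w :: k) m' s) = Config k (iter N F m') s.
    elim: N m' => [|N IHN] m' en ed ea.
      exists 1%N => //=; rewrite addn0 in ea.
      suff -> : (nmem m' a 0 0 + 1 <= nmem m' (limv l 0 1) 0 0)%N = false by [].
      by rewrite ea /bound; case: (l); rewrite /= ?en ?ed; lia.
    have [N1 h1 e1] := IHp m'
      (NSet a (NConst 0) (NConst 0) (NAdd (cell a) (NConst 1)) :: w :: k) wp.
    have [fr _] := frame p m'.
    have [|||N2 h2 e2] := IHN (F m').
    + by rewrite /= upd_other ?fr ?wf_nwrites //; lia.
    + by rewrite /= upd_other ?fr ?wf_nwrites //; lia.
    + by rewrite /= /upd !eqxx /= fr //; lia.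
    exists (N1 + N2 + 3)%N; first by move: h1 h2; rewrite en ed; nia.
    have hb : (nmem m' a 0 0 + 1 <= nmem m' (limv l 0 1) 0 0)%N.
      by move: ea; rewrite /bound; case: (l); rewrite /= ?en ?ed; lia.
    rewrite addn3 2!iterSr /= hb -iterS -addnS.
    apply: (iterD_config e1); rewrite iterSr /= addn1.
    by rewrite e2 -iterS iterSr.
  have [|||N h e] := key (bound l m) (nupd m a 0 0 0).
  + by rewrite /= upd_other //; lia.
  + by rewrite /= upd_other //; lia.
  + by rewrite /= /upd !eqxx.
  exists N.+2; first by rewrite [X in (_ <= X)%N]addn3 !ltnS -addn1.
  by rewrite 2!iterSr.
Qed.

End Exec.

Lemma poly_add f1 f2 :
  (exists C, forall n d, f1 n d <= time_bound C n d)%N ->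
  (exists C, forall n d, f2 n d <= time_bound C n d)%N ->
  (exists C, forall n d, f1 n d + f2 n d <= time_bound C n d)%N.
Proof.
move=> [C1 h1] [C2 h2]; exists (C1 + C2)%N => n d.
rewrite /time_bound mulnDl leq_add //.
  apply: leq_trans (h1 n d) _; rewrite leq_mul2l leq_pexp2l ?orbT //; lia.
apply: leq_trans (h2 n d) _; rewrite leq_mul2l leq_pexp2l ?orbT //; lia.
Qed.

Lemma poly_mul f1 f2 :
  (exists C, forall n d, f1 n d <= time_bound C n d)%N ->
  (exists C, forall n d, f2 n d <= time_bound C n d)%N ->
  (exists C, forall n d, f1 n d * f2 n d <= time_bound C n d)%N.
Proof.
move=> [C1 h1] [C2 h2]; exists (C1 * C2 + C1 + C2)%N => n d.
apply: leq_trans (leq_mul (h1 n d) (h2 n d)) _; rewrite /time_bound.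
rewrite mulnACA -expnD leq_mul ?leq_pexp2l //; lia.
Qed.

Lemma poly_const c : (exists C, forall n d, c <= time_bound C n d)%N.
Proof.
by exists c => n d; rewrite /time_bound leq_pmulr // expn_gt0.
Qed.

Lemma poly_cost p : exists C, forall n d, (cost n d p <= time_bound C n d)%N.
Proof.
elim: p => [|a i j x|a i j x|p IHp q IHq|b p IHp q IHq|a l p IHp] /=;
  try exact: poly_const.
- have [C h] := poly_add (poly_add IHp IHq) (poly_const 1).
  by exists C => n d; rewrite -addn1.
- have [C h] := poly_add (poly_add IHp IHq) (poly_const 1).
  by exists C => n d; rewrite -addn1.
- apply: (@poly_add (fun n d => limv l n d * (cost n d p + 3))%N _ _ (poly_const 3)).
  apply: poly_mul; last exact: (poly_add IHp (poly_const 3)).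
  by exists 1%N => n d; rewrite /time_bound expn1 mul1n; case: l => /=; lia.
Qed.

Lemma iter_halted (g : nat -> R) N m s :
  iter N (step g) (Config [::] m s) = Config [::] m s.
Proof. by elim: N => //= N ->. Qed.

(** A halted configuration is a fixed point of [step], so the possibly smaller exact number of steps
    can be replaced by the polynomial bound. *)
Lemma run_compile p : wf p ->
  exists C, forall (m : memory R) g,
    let c := run (compile p) g m (time_bound C (nmem m 0 0 0) (nmem m 1 0 0)) in
    halted c /\ store c = sem p m.
Proof.
move=> wp; have [C hC] := poly_cost p; exists C => m g.
have [N hN e] := exec g m [::] 0 wp.
suff -> : run (compile p) g m (time_bound C (nmem m 0 0 0) (nmem m 1 0 0)) =
  Config [::] (sem p m) 0 by [].
rewrite /run -(subnKC (leq_trans hN (hC _ _))).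
exact: (iterD_config e (iter_halted _ _ _ _)).
Qed.

End Sem.

(** * Invariants for loops that fill arrays and compute sums *)

Section Loops.
Context (R : realType).
Implicit Types (m : memory R) (p q : prog).

Lemma agree_bound nl rl m m' l : agree nl rl m m' ->
  0%N \notin nl -> 1%N \notin nl -> bound l m' = bound l m.
Proof. by move=> [h _] h0 h1; rewrite /bound !h. Qed.

(** The body may use the old value of its own cell, as updates in place do, because the invariant
    keeps the cells not yet visited at their initial value. *)
Lemma map1_spec out a l p m (f : nat -> R) : wf (For a l p) ->
  (forall i m', (i < bound l m)%N -> agree (a :: nwrites p) (rwrites p) m m' ->
     nmem m' a 0 0 = i -> rmem m' out 0 i = rmem m out 0 i ->
     rmem (sem p m') out 0 i = f i /\
     forall i', i' != i -> rmem (sem p m') out 0 i' = rmem m' out 0 i') ->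
  forall i, (i < bound l m)%N -> rmem (sem (For a l p) m) out 0 i = f i.
Proof.
move=> wp h i hi.
have [|N m' hN hm hc [I1 I2]|h1 _] := @for_inv R (fun N m' =>
  (forall i, i < N -> rmem m' out 0 i = f i)%N /\
  (forall i, N <= i -> rmem m' out 0 i = rmem m out 0 i)%N) a l p m wp.
- by split.
- have [e1 e2] := h N m' hN hm hc (I2 N (leqnn _)).
  split=> i' /= hi'.
    move: hi'; rewrite ltnS leq_eqVlt => /predU1P[->//|hi'].
    by rewrite e2 ?I1 // ltn_eqF.
  by rewrite e2 ?I2 ?gtn_eqF // ltnW.
- exact: h1.
Qed.

Lemma map2_spec out a l b l' p m (f : nat -> nat -> R) :
  wf (For a l (For b l' p)) ->
  (forall i j m', (i < bound l m)%N -> (j < bound l' m)%N ->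
     agree (a :: b :: nwrites p) (rwrites p) m m' ->
     nmem m' a 0 0 = i -> nmem m' b 0 0 = j ->
     rmem m' out i j = rmem m out i j ->
     rmem (sem p m') out i j = f i j /\
     forall i' j', (i', j') != (i, j) ->
       rmem (sem p m') out i' j' = rmem m' out i' j') ->
  forall i j, (i < bound l m)%N -> (j < bound l' m)%N ->
    rmem (sem (For a l (For b l' p)) m) out i j = f i j.
Proof.
move=> wp h i j hi hj.
have wp2 : wf (For b l' p) by case/and3P: wp.
have /= /and3P[ha hab _] := wp.
have /= /and3P[hb hbp wp'] := wp2.
have n0 : 0%N \notin [:: a, b & nwrites p].
  by rewrite !inE !negb_or wf_nwrites // andbT; lia.
have n1 : 1%N \notin [:: a, b & nwrites p].
  by rewrite !inE !negb_or wf_nwrites // andbT; lia.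
have [|N m' hN hm hc [I1 I2]|h1 _] := @for_inv R (fun N m' =>
  (forall i j, i < N -> j < bound l' m -> rmem m' out i j = f i j)%N /\
  (forall i j, N <= i -> rmem m' out i j = rmem m out i j)%N)
   a l (For b l' p) m wp.
- by split.
- have hbd : bound l' m' = bound l' m by rewrite (agree_bound l' hm).
  (* Cells before [(N, j0)] in lexicographic order are final or, beyond the columns visited,
     irrelevant; those from [(N, j0)] on are untouched. *)
  have /= := @for_inv R (fun j0 m2 =>
     (forall i j, i < N -> j < bound l' m -> rmem m2 out i j = f i j)%N /\
     (forall j, j < j0 -> rmem m2 out N j = f N j)%N /\
     (forall i j, (N < i) || (N == i) && (j0 <= j) ->
       rmem m2 out i j = rmem m out i j)%N)
     b l' p m' wp2.
  rewrite hbd => -[||H1 [H2 H3]].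
  + split=> //=; split=> // i' j'; case/orP=> [hi'|/andP[/eqP <- _]].
      by rewrite I2 // ltnW.
    by rewrite I2.
  + move=> j0 m2 hj0 hm2 hc2 [J1 [J2 J3]].
    have hm3 : agree [:: a, b & nwrites p] (rwrites p) m m2.
      apply: agree_trans hm _; apply: agree_sub hm2 => // z.
      by rewrite inE => /orP[/eqP ->|hz]; rewrite !inE ?eqxx ?hz !orbT.
    have hca : nmem m2 a 0 0 = N by rewrite (proj1 hm2).
    have [|e1 e2] := h N j0 m2 hN hj0 hm3 hca hc2.
      by rewrite J3 // eqxx leqnn orbT.
    split=> [i' j' hi' hj'|]; last split=> [j'|i' j'] /=.
    * by rewrite /= e2 ?J1 // xpair_eqE ltn_eqF.
    * rewrite ltnS leq_eqVlt => /predU1P[->//|hj'].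
      by rewrite e2 ?J2 // xpair_eqE (ltn_eqF hj') andbF.
    * move=> hh; rewrite e2 ?J3 //.
        by case/orP: hh => [->//|/andP[-> /ltnW ->]]; rewrite orbT.
      rewrite xpair_eqE; case/orP: hh => [/gtn_eqF ->//|/andP[_ /gtn_eqF ->]].
      by rewrite andbF.
  + split=> [i' j'|i' j' hi'].
      by rewrite ltnS leq_eqVlt => /predU1P[->|hi'] hj'; [apply: H2|apply: H1].
    by apply: H3; rewrite hi'.
- exact: h1.
Qed.

Definition rsum out I J a l t :=
  Sq (PR out I J (RNat (NConst 0)))
     (For a l (PR out I J (RAdd (RGet out I J) t))).

(** The address of the accumulator is evaluated anew at each turn, hence the hypothesis that it
    survives changes to the counter and to [out]. *)
Lemma rsum_spec out I J a l t m i0 j0 (f : nat -> R) :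
  (1 < a)%N ->
  (forall m', agree [:: a] [:: out] m m' -> neval m' I = i0 /\ neval m' J = j0) ->
  (forall c m', (c < bound l m)%N -> agree [:: a] [:: out] m m' ->
     nmem m' a 0 0 = c -> reval m' t = f c) ->
  forall i j, rmem (sem (rsum out I J a l t) m) out i j =
    if (i == i0) && (j == j0) then \sum_(c < bound l m) f c else rmem m out i j.
Proof.
move=> ha hIJ ht.
have [eI eJ] := hIJ m (agree_refl _ _ _).
pose m1 := rupd m out i0 j0 0.
have a1 : agree [:: a] [:: out] m m1 by apply: agree_rupd; rewrite inE.
have b1 : bound l m1 = bound l m by [].
have wf1 : wf (For a l (PR out I J (RAdd (RGet out I J) t))) by rewrite /= ha.
have -> : sem (rsum out I J a l t) m =
  sem (For a l (PR out I J (RAdd (RGet out I J) t))) m1.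
  by rewrite /m1 -eI -eJ.
rewrite -b1; apply: (@for_inv R (fun N m' => forall i j, rmem m' out i j =
  if (i == i0) && (j == j0) then \sum_(c < N) f c else rmem m out i j) a l _ m1 wf1).
- by move=> i j /=; rewrite /upd eqxx /= big_ord0.
- move=> N m' hN hm hc I1 i j /=.
  have hm' := agree_trans a1 hm.
  have [eI' eJ'] := hIJ m' hm'.
  rewrite /upd eqxx eI' eJ' /= (ht N) //; case: ifP => [h|h]; last first.
    by rewrite I1 h.
  by rewrite I1 !eqxx big_ord_recr.
Qed.

(** The walk counts its steps by two nested loops. Here they become a single loop indexed by the
    total number of steps, for invariants that do not see the two counters. *)
Lemma iter2_inv (I : nat -> memory R -> Prop) a l b l' p m :
  wf (For a l (For b l' p)) ->
  (forall N m' x, I N m' -> I N (nupd m' a 0%N 0%N x)) ->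
  (forall N m' x, I N m' -> I N (nupd m' b 0%N 0%N x)) ->
  I 0%N m ->
  (forall N m', (N < bound l m * bound l' m)%N ->
     agree (a :: b :: nwrites p) (rwrites p) m m' -> I N m' ->
     I N.+1 (sem p m')) ->
  I (bound l m * bound l' m)%N (sem (For a l (For b l' p)) m).
Proof.
move=> wp ia ib I0 IS.
have wp2 : wf (For b l' p) by case/and3P: wp.
have /= /and3P[ha hab _] := wp.
have /= /and3P[hb hbp wp'] := wp2.
have n0 : 0%N \notin [:: a, b & nwrites p].
  by rewrite !inE !negb_or wf_nwrites // andbT; lia.
have n1 : 1%N \notin [:: a, b & nwrites p].
  by rewrite !inE !negb_or wf_nwrites // andbT; lia.
apply: (@for_inv R (fun N m' => I (N * bound l' m)%N m') a l (For b l' p) m wp).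
  exact: ia.
move=> N m' hN hm hc hI; apply: ia.
have hbd : bound l' m' = bound l' m by rewrite (agree_bound l' hm).
have := @for_inv R (fun j m2 => I (N * bound l' m + j)%N m2) b l' p m' wp2.
rewrite hbd mulSnr; apply.
  by apply: ib; rewrite addn0.
move=> j m2 hj hm2 hc2 hI2; apply: ib; rewrite addnS; apply: IS hI2.
  by nia.
apply: agree_trans hm _; apply: agree_sub hm2 => // z.
by rewrite inE => /orP[/eqP ->|hz]; rewrite !inE ?eqxx ?hz !orbT.
Qed.

End Loops.

(** * The algorithm *)

Local Notation n0 := (NConst 0).
Local Notation n1 := (NConst 1).
Local Notation vi := (cell 5).
Local Notation vj := (cell 6).
Local Notation vc := (cell 7).
Local Notation rc a := (RGet a n0 n0).
Local Notation "p ;; q" := (Sq p q) (at level 60, right associativity).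

(* Memory layout. Naturals: 5, 6, 7 hold the indices [i], [j], [c] and 8, 9 the
   step counters; 10 holds the numerator of the step size, 11 the coordinate of
   the next move, 12 the size of the biclique and 13 a counter.
   Reals: 3 [a], 4 [b], 5 [k], 6 the harmonic number [H] of [n], 7 [r],
   8 the step size, 9 [eps], 10 [beta = 1 - eps / 2], 11 [x], 12 [y],
   13 [<x_i, y_j>], 14 the coefficients of [p i * q j] in the potential, 15 [p],
   16 [q], 17 [K], 18 [L], 19 the potential, 20 and 21 the signed step tried and
   retained, 22 [\sum q] and 23 the weight of the non-neighbours of [i].
   The factors [beta] compensate the average of [<x_i, y_j>], which the
   truncation of the weights may lower to [-1 / 2]. *)
Definition prod_with_e arr out : prog :=
  For 5 Ln (rsum out n0 vi 7 Ld (RMul (RGet arr vi vc) (RGet 0 n0 vc))).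

(** The harmonic number replaces [log n]: it exceeds it by at most 1. *)
Definition scalars : prog :=
  rsum 5 n0 n0 5 Ln (RGet 3 n0 vi) ;;
  rsum 6 n0 n0 5 Ln (RDiv (RNat n1) (RNat (NAdd vi n1))) ;;
  PR 7 n0 n0 (RDiv (RMul (RNat (NConst 4)) (RNat (cell 0))) (rc 5)).

(* The machine has no square roots: [j] is the integer part of
   [sqrt (H k / 128)]. *)
Definition root_search : prog :=
  PN 10 n0 n0 n0 ;;
  For 5 Ln
    (Cond (BRle (RMul (RNat (NConst 128))
                   (RMul (RNat (NAdd (cell 10) n1)) (RNat (NAdd (cell 10) n1))))
                (RMul (rc 6) (rc 5)))
       (PN 10 n0 n0 (NAdd (cell 10) n1)) Nop).

Definition stepsize : prog :=
  PR 8 n0 n0 (RDiv (RNat (cell 10)) (RNat (cell 0))) ;;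
  PR 9 n0 n0 (RDiv (RMul (rc 8) (rc 8)) (RNat (cell 1))) ;;
  PR 10 n0 n0 (RSub (RNat n1) (RDiv (rc 9) (RNat (NConst 2)))).

Definition recenter arr nrm out : prog :=
  For 5 Ln (For 7 Ld
    (PR out vi vc (RSub (RDiv (RGet arr vi vc) (RGet nrm n0 vi)) (RGet 0 n0 vc)))).

Definition gram : prog :=
  For 5 Ln (For 6 Ln
    (rsum 13 vi vj 7 Ld (RMul (RGet 11 vi vc) (RGet 12 vj vc)))).

(** The test is [a i >= k / (4 n)] multiplied out. It discards in particular the vertices with
    [a i = 0], for which the quotient in [recenter] has no meaning. *)
Definition select nrm out : prog :=
  For 5 Ln
    (Cond (BRle (RNat n1) (RMul (rc 7) (RGet nrm n0 vi)))
       (PR out n0 vi (RGet nrm n0 vi)) (PR out n0 vi (RNat n0))).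

Definition growth : rexp :=
  RDiv (RAdd (RNat n1) (RMul (rc 9) (RGet 13 vi vj))) (rc 10).

(** [NSub n1 (NGet 2 vi vj)] is the indicator of a non-edge. Dividing by [growth] at each of the
    [n * d] steps finally brings the coefficient of a relevant pair to 1 on an edge and to [1 - K]
    on a non-edge. *)
Definition weights : prog :=
  For 5 Ln (For 6 Ln (PR 14 vi vj (RNat n1))) ;;
  For 8 Ln (For 9 Ld
    (For 5 Ln (For 6 Ln (PR 14 vi vj (RMul (RGet 14 vi vj) growth))))) ;;
  For 5 Ln (For 6 Ln
    (PR 14 vi vj (RSub (RGet 14 vi vj)
      (RDiv (RNat (NSub n1 (NGet 2 vi vj))) (RNat (NConst 2)))))).

(** [1 / 2] is the initial loss on non-edges, as in [weights]. With [k / 16] the two penalties cost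
    at most [k ^ 2 / 8], less than the [9 k ^ 2 / 32] guaranteed for the rest. *)
Definition levels : prog :=
  PR 17 n0 n0 (RDiv (RNat n1) (RNat (NConst 2))) ;;
  PR 18 n0 n0 (RDiv (rc 5) (RNat (NConst 16))).

(** On a non-edge [growth] is [(1 - eps) / beta], so [K] increases. [L] is divided by
    [(1 + eps * r) / beta] because [p i ^ 2] grows on average by at most [1 + eps * r]. *)
Definition decay : prog :=
  PR 17 n0 n0 (RMul (rc 17) (RDiv (rc 10) (RSub (RNat n1) (rc 9)))) ;;
  PR 18 n0 n0 (RMul (rc 18)
    (RDiv (rc 10) (RAdd (RNat n1) (RMul (rc 9) (rc 7))))) ;;
  For 5 Ln (For 6 Ln (PR 14 vi vj (RDiv (RGet 14 vi vj) growth))).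

Definition moved arr wt (sg : rexp) (v c : nexp) : rexp :=
  RMul (RGet wt n0 v) (RAdd (RNat n1) (RMul sg (RGet arr v c))).

Definition acc a t : prog := For a Ln (PR 19 n0 n0 (RAdd (rc 19) t)).

Definition penalty arr wt : rexp :=
  RMul (RSub (RNat n0) (rc 18))
    (RMul (moved arr wt (rc 20) vi vc) (moved arr wt (rc 20) vi vc)).

Definition potential : prog :=
  PR 19 n0 n0 (RNat n0) ;;
  For 5 Ln (acc 6 (RMul (RGet 14 vi vj)
      (RMul (moved 11 15 (rc 20) vi vc) (moved 12 16 (rc 20) vj vc)))) ;;
  acc 5 (penalty 11 15) ;;
  acc 5 (penalty 12 16).

(** Every success overwrites the previous one, so [search] retains the last move that keeps the
    potential positive. That one exists is the content of [potential_step]. *)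
Definition attempt (sg : rexp) : prog :=
  PR 20 n0 n0 sg ;;
  potential ;;
  Cond (BRle (rc 19) (RNat n0)) Nop
    (PN 11 n0 n0 vc ;; PR 21 n0 n0 (rc 20)).

Definition search : prog :=
  For 7 Ld (attempt (rc 8) ;; attempt (RSub (RNat n0) (rc 8))).

Definition move : prog :=
  For 5 Ln (PR 15 n0 vi (moved 11 15 (rc 21) vi (cell 11))) ;;
  For 5 Ln (PR 16 n0 vi (moved 12 16 (rc 21) vi (cell 11))).

Definition descent : prog :=
  For 8 Ln (For 9 Ld (decay ;; search ;; move)).

Definition shrink : prog :=
  PN 3 n0 vi n1 ;;
  PN 12 n0 n0 (NAdd (cell 12) n1) ;;
  For 6 Ln (PN 4 n0 vj (NSub (NGet 4 n0 vj) (NSub n1 (NGet 2 vi vj)))).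

(** The second test keeps the set at most as large as its common neighbourhood; no target size is
    involved. *)
Definition extract : prog :=
  rsum 22 n0 n0 5 Ln (RGet 16 n0 vi) ;;
  For 5 Ln (PN 4 n0 vi n1) ;;
  For 5 Ln
    (rsum 23 n0 n0 6 Ln (RMul (RNat (NSub n1 (NGet 2 vi vj))) (RGet 16 n0 vj)) ;;
     PN 13 n0 n0 n0 ;;
     For 6 Ln (PN 13 n0 n0
       (NAdd (cell 13) (NSub (NGet 4 n0 vj) (NSub n1 (NGet 2 vi vj))))) ;;
     Cond (BAnd (BRle (RMul (rc 17) (rc 23)) (RMul (RNat (NConst 2)) (rc 22)))
                (BNle (NAdd (cell 12) n1) (cell 13)))
       shrink Nop).

Definition balance : prog :=
  PN 13 n0 n0 n0 ;;
  For 5 Ln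
    (Cond (BAnd (BNle n1 (NGet 4 n0 vi)) (BNle (NAdd (cell 13) n1) (cell 12)))
       (PN 13 n0 n0 (NAdd (cell 13) n1)) (PN 4 n0 vi n0)).

Definition setup : prog :=
  prod_with_e 1 3 ;; prod_with_e 2 4 ;; scalars ;; root_search ;; stepsize ;;
  levels ;; recenter 1 3 11 ;; recenter 2 4 12 ;; gram ;; select 3 15 ;; select 4 16 ;;
  weights.

Definition algorithm : prog := setup ;; descent ;; extract ;; balance.

Lemma wf_algorithm : wf algorithm.
Proof. by []. Qed.

(** * What the pieces of the program compute *)

Section Specs.
Context (R : realType).
Implicit Types (m : memory R).

Lemma prod_with_e_spec arr out m : (3 <= out)%N -> arr != out -> 
  forall i, (i < nmem m 0 0 0)%N ->
  rmem (sem (prod_with_e arr out) m) out 0 i =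
    \sum_(c < nmem m 1 0 0) rmem m arr i c * rmem m 0 0 c.
Proof.
move=> h3 hao i hi.
apply: (map1_spec (f := fun i => \sum_(c < nmem m 1 0 0) rmem m arr i c * rmem m 0 0 c)) => //.
move=> {hi}i m' hi [hn hr] hc _.
have hs := @rsum_spec R out n0 vi 7 Ld (RMul (RGet arr vi vc) (RGet 0 n0 vc))
  m' 0 i (fun c => rmem m arr i c * rmem m 0 0 c).
split=> [|i' hi']; rewrite hs //.
- by rewrite !eqxx /= /bound /= !hn.
- by move=> m2 [h2 _] /=; rewrite h2.
- move=> c m2 _ [h2 h2r] /= ec.
  by rewrite ec h2 // hc !h2r ?hr //= ?inE; lia.
- by rewrite (negPf hi') andbF.
- by move=> m2 [h2 _] /=; rewrite h2.
- move=> c m2 _ [h2 h2r] /= ec.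
  by rewrite ec h2 // hc !h2r ?hr //= ?inE; lia.
Qed.


Lemma scalars_spec m (m' := sem scalars m) (n := nmem m 0 0 0)
    (k := \sum_(i < n) rmem m 3 0 i) :
  [/\ rmem m' 5 0 0 = k,
      rmem m' 6 0 0 = \sum_(i < n) (i.+1%:R)^-1 &
      rmem m' 7 0 0 = 4 * n%:R / k].
Proof.
rewrite /m' /scalars; set s1 := rsum 5 _ _ _ _ _; set s2 := rsum 6 _ _ _ _ _.
rewrite -[sem _ m]/(rupd (sem s2 (sem s1 m)) 7%N 0%N 0%N
  (4 * (nmem (sem s2 (sem s1 m)) 0 0 0)%:R / rmem (sem s2 (sem s1 m)) 5 0 0)).
have e1 : rmem (sem s1 m) 5 0 0 = k.
  rewrite (@rsum_spec R 5 n0 n0 5 Ln _ m 0 0 (fun i => rmem m 3 0 i)) //.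
  by move=> c m2 _ [_ h2] /= ->; rewrite h2.
have e2 : rmem (sem s2 (sem s1 m)) 6 0 0 = \sum_(i < n) (i.+1%:R)^-1.
  rewrite (@rsum_spec R 6 n0 n0 5 Ln _ (sem s1 m) 0 0 (fun i => (i.+1%:R)^-1)) //=.
    by rewrite /bound /= !(proj1 (frame s1 m)).
  by move=> c m2 _ [_ h2] /= ->; rewrite addn1 mul1r.
have e3 : rmem (sem s2 (sem s1 m)) 5 0 0 = k.
  by rewrite (proj2 (frame s2 _)).
have e4 : nmem (sem s2 (sem s1 m)) 0 0 0 = n.
  by rewrite (proj1 (frame s2 _)) // (proj1 (frame s1 _)).
move: (sem s2 _) e2 e3 e4 => m2 e2 e3 e4.
by rewrite /= /upd /= e2 e3 e4.
Qed.

Lemma root_search_spec m (m' := sem root_search m) (n := nmem m 0 0 0)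
    (x := rmem m 6 0 0 * rmem m 5 0 0) (j := nmem m' 10 0 0) :
  [/\ (j <= n)%N, (0 < j)%N -> 128 * (j%:R * j%:R) <= x &
      (j < n)%N -> x < 128 * (j.+1%:R * j.+1%:R)].
Proof.
pose p := Cond (BRle (RMul (RNat (NConst 128))
                   (RMul (RNat (NAdd (cell 10) n1)) (RNat (NAdd (cell 10) n1))))
                (RMul (rc 6) (rc 5)))
       (PN 10 n0 n0 (NAdd (cell 10) n1)) Nop.
have := @for_inv R (fun N m' => let j := nmem m' 10 0 0 in
  [/\ (j <= N)%N, (0 < j)%N -> 128 * (j%:R * j%:R) <= x &
      (j < N)%N -> x < 128 * (j.+1%:R * j.+1%:R)]) 5 Ln p (nupd m 10%N 0%N 0%N 0%N) erefl.
apply; first by split.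
move=> N m2 hN [_ hr] hc [h1 h2 h3] /=.
rewrite !hr //= -/x addn1; case: ifP => [hle|hlt] /=; rewrite /upd /=; split=> //.
- by move=> hlt; move: hle; rewrite leNgt h3.
- exact: leqW.
- by rewrite ltNge hlt.
Qed.

Lemma stepsize_spec m (m' := sem stepsize m)
    (s := (nmem m 10 0 0)%:R / (nmem m 0 0 0)%:R)
    (eps := s * s / (nmem m 1 0 0)%:R) :
  [/\ rmem m' 8 0 0 = s, rmem m' 9 0 0 = eps & rmem m' 10 0 0 = 1 - eps / 2].
Proof. by rewrite /m' /=. Qed.

Lemma recenter_spec arr nrm out m (hw : out \notin [:: 0; arr; nrm]%N) i c :
  (i < nmem m 0 0 0)%N -> (c < nmem m 1 0 0)%N ->
  rmem (sem (recenter arr nrm out) m) out i c =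
  rmem m arr i c / rmem m nrm 0 i - rmem m 0 0 c.
Proof.
move: hw; rewrite !inE !negb_or => /and3P[w1 w2 w3] hi hc.
apply: (map2_spec (f := fun i c => rmem m arr i c / rmem m nrm 0 i - rmem m 0 0 c)) => //.
move=> {hi hc} {}i {}c m' hi hc' [hn hr] /= ei ec _.
rewrite ei ec; split=> [|i' j' hij].
  by rewrite /upd !eqxx /= !hr //= inE eq_sym.
by rewrite /upd eqxx /= -xpair_eqE (negPf hij).
Qed.

Lemma gram_spec m i j : (i < nmem m 0 0 0)%N -> (j < nmem m 0 0 0)%N ->
  rmem (sem gram m) 13 i j =
  \sum_(c < nmem m 1 0 0) rmem m 11 i c * rmem m 12 j c.
Proof.
move=> hi hj.
apply: (map2_spec (f := fun i j =>
  \sum_(c < nmem m 1 0 0) rmem m 11 i c * rmem m 12 j c)) => //.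
move=> {hi hj} {}i {}j m' hi hj [hn hr] ei ej _.
have hs := @rsum_spec R 13 vi vj 7 Ld (RMul (RGet 11 vi vc) (RGet 12 vj vc))
  m' i j (fun c => rmem m 11 i c * rmem m 12 j c).
have {}hs i' j' : rmem (sem (rsum 13 vi vj 7 Ld (RMul (RGet 11 vi vc) (RGet 12 vj vc))) m') 13 i' j' =
  if (i' == i) && (j' == j) then \sum_(c < nmem m 1 0 0) rmem m 11 i c * rmem m 12 j c else rmem m' 13 i' j'.
  rewrite hs //.
  - by rewrite /bound /= !hn.
  - by move=> m2 [h2 _] /=; rewrite !h2.
  - by move=> c m2 _ [h2 h2r] /= ->; rewrite !h2 // ei ej !h2r // !hr.
split=> [|i' j' hij]; rewrite hs ?eqxx //.
by rewrite -xpair_eqE (negPf hij).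
Qed.

Lemma select_spec nrm out m i : out \notin [:: 7; nrm]%N ->
  (i < nmem m 0 0 0)%N ->
  rmem (sem (select nrm out) m) out 0 i =
  if 1 <= rmem m 7 0 0 * rmem m nrm 0 i then rmem m nrm 0 i else 0.
Proof.
rewrite !inE !negb_or => /andP[w1 w2] hi.
apply: (map1_spec (f := fun i =>
  if 1 <= rmem m 7 0 0 * rmem m nrm 0 i then rmem m nrm 0 i else 0)) => //.
move=> {hi}i m' hi [hn hr] /= ei _; rewrite ei.
have -> : rmem m' 7 0 0 = rmem m 7 0 0 by rewrite hr //= !inE ![7%N == _]eq_sym negb_or w1.
have -> : rmem m' nrm 0 i = rmem m nrm 0 i by rewrite hr //= !inE ![nrm == _]eq_sym negb_or w2.
case: ifP => _ /=; rewrite /upd !eqxx /=; split=> // i' hi'.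
  by rewrite (negPf hi').
by rewrite (negPf hi').
Qed.

Definition growth_at m i j : R :=
  (1 + rmem m 9 0 0 * rmem m 13 i j) / rmem m 10 0 0.

Lemma weights_spec m i j : (i < nmem m 0 0 0)%N -> (j < nmem m 0 0 0)%N ->
  rmem (sem weights m) 14 i j =
  growth_at m i j ^+ (nmem m 0 0 0 * nmem m 1 0 0) - (1 - nmem m 2 i j)%:R / 2.
Proof.
move=> hi hj; rewrite /weights.
set w1 := For 5 Ln _; set p := For 5 Ln (For 6 Ln (PR 14 _ _ (RMul _ _))).
set w2 := For 8 Ln _; set w3 := For 5 Ln (For 6 Ln (PR 14 _ _ (RSub _ _))).
rewrite -[sem _ m]/(sem w3 (sem w2 (sem w1 m))).
set m1 := sem w1 m; set m2 := sem w2 m1.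
have [f1n f1r] := frame w1 m.
have [f2n f2r] := frame w2 m1.
have e1 i' j' : (i' < nmem m 0 0 0)%N -> (j' < nmem m 0 0 0)%N -> rmem m1 14 i' j' = 1.
  move=> hi' hj'; apply: (map2_spec (f := fun i j => 1)) => //.
  move=> {hi' hj'} {}i' {}j' m' hi' hj' _ /= -> -> _; rewrite /upd !eqxx; split=> //.
  by move=> a b hab; rewrite -xpair_eqE (negPf hab).
have hp N m' : agree [:: 8; 9; 5; 6]%N [:: 14]%N m1 m' ->
  (forall i' j', (i' < nmem m 0 0 0)%N -> (j' < nmem m 0 0 0)%N ->
     rmem m' 14 i' j' = growth_at m i' j' ^+ N) ->
  (forall i' j', (i' < nmem m 0 0 0)%N -> (j' < nmem m 0 0 0)%N ->
     rmem (sem p m') 14 i' j' = growth_at m i' j' ^+ N.+1).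
  move=> [ha hb] h i' j' hi' hj'.
  apply: (map2_spec (f := fun i j => growth_at m i j ^+ N.+1)) => //; try by rewrite /bound /= ha // f1n.
  move=> {hi' hj'} {}i' {}j' m3; rewrite /bound /= !ha // !f1n // => hi' hj' [h3n h3r] /= ei ej ew.
  rewrite ei ej; split=> [|a b hab].
    rewrite /upd !eqxx /= ew h // exprSr /growth_at.
    by rewrite !h3r // !hb // !f1r.
  by rewrite /upd eqxx /= -xpair_eqE (negPf hab).
have e2 : forall i' j', (i' < nmem m 0 0 0)%N -> (j' < nmem m 0 0 0)%N ->
    rmem m2 14 i' j' = growth_at m i' j' ^+ (nmem m 0 0 0 * nmem m 1 0 0).
  have hb : bound Ln m1 = nmem m 0 0 0 by rewrite /bound /= f1n.
  have hd : bound Ld m1 = nmem m 1 0 0 by rewrite /bound /= f1n.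
  have := @iter2_inv R (fun N m' => forall i' j', (i' < bound Ln m1)%N ->
    (j' < bound Ln m1)%N -> rmem m' 14 i' j' = growth_at m i' j' ^+ N)
    8 Ln 9 Ld p m1 isT.
  rewrite hb hd => h; by apply: h => //= N m' _ hm'; apply: hp.
have bm2 : bound Ln m2 = nmem m 0 0 0 by rewrite /bound /= f2n // f1n.
apply: (map2_spec (f := fun i j =>
  growth_at m i j ^+ (nmem m 0 0 0 * nmem m 1 0 0) - (1 - nmem m 2 i j)%:R / 2));
  rewrite ?bm2 //.
move=> {hi hj} {}i {}j m'; rewrite ?bm2 => hi hj [hn hr] /= ei ej ew.
rewrite ei ej; split=> [|a b hab].
  by rewrite /upd !eqxx /= ew e2 // hn // f2n // f1n.
by rewrite /upd eqxx /= -xpair_eqE (negPf hab).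
Qed.

Lemma levels_spec m (m' := sem levels m) :
  rmem m' 17 0 0 = 1 / 2 /\ rmem m' 18 0 0 = rmem m 5 0 0 / 16.
Proof. by []. Qed.

Lemma decay_spec m (m' := sem decay m) (eps := rmem m 9 0 0) (beta := rmem m 10 0 0) :
  [/\ rmem m' 17 0 0 = rmem m 17 0 0 * (beta / (1 - eps)),
      rmem m' 18 0 0 = rmem m 18 0 0 * (beta / (1 + eps * rmem m 7 0 0)) &
      forall i j, (i < nmem m 0 0 0)%N -> (j < nmem m 0 0 0)%N ->
        rmem m' 14 i j = rmem m 14 i j / growth_at m i j].
Proof.
rewrite /m' /decay; set p := For 5 Ln _.
set m1 := rupd (rupd m 17%N 0%N 0%N (rmem m 17 0 0 * (beta / (1 - eps)))) 18%N 0%N 0%N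
  (rmem m 18 0 0 * (beta / (1 + eps * rmem m 7 0 0))).
rewrite -[sem _ m]/(sem p m1).
have [hn hr] := frame p m1.
split; [by rewrite hr|by rewrite hr|].
move=> i j hi hj.
apply: (map2_spec (f := fun i j => rmem m 14 i j / growth_at m i j)) => //.
move=> {hi hj} {}i {}j m2 hi hj [h2n h2r] /= ei ej ew.
rewrite ei ej; split=> [|a b hab].
  by rewrite /upd !eqxx /= ew !h2r.
by rewrite /upd eqxx /= -xpair_eqE (negPf hab).
Qed.

Lemma acc_spec a t m (f : nat -> R) : (1 < a)%N ->
  (forall c m', (c < nmem m 0 0 0)%N -> agree [:: a] [:: 19]%N m m' ->
     nmem m' a 0 0 = c -> reval m' t = f c) ->
  rmem (sem (acc a t) m) 19 0 0 = rmem m 19 0 0 + \sum_(c < nmem m 0 0 0) f c.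
Proof.
move=> ha ht.
have wp : wf (acc a t) by rewrite /= ha.
apply: (@for_inv R (fun N m' =>
  rmem m' 19 0 0 = rmem m 19 0 0 + \sum_(c < N) f c) a Ln _ m wp).
  by rewrite big_ord0 addr0.
move=> N m' hN hm hc hI /=.
by rewrite /upd /= hI (ht N) // big_ord_recr addrA.
Qed.

Definition Phi n (W : nat -> nat -> R) (L : R) (p q : nat -> R) : R :=
  \sum_(i < n) \sum_(j < n) W i j * (p i * q j) +
  \sum_(i < n) - L * (p i * p i) + \sum_(j < n) - L * (q j * q j).

Definition pot m s c : R :=
  Phi (nmem m 0 0 0) (rmem m 14) (rmem m 18 0 0)
    (fun i => rmem m 15 0 i * (1 + s * rmem m 11 i c))
    (fun j => rmem m 16 0 j * (1 + s * rmem m 12 j c)).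

Lemma pot_agree nl rl m m' s c : agree nl rl m m' -> 0%N \notin nl ->
  ~~ has (mem rl) [:: 11; 12; 14; 15; 16; 18]%N -> pot m' s c = pot m s c.
Proof.
move=> [hn hr] h0 /=; rewrite !negb_or => /and5P[h11 h12 h14 h15 /and3P[h16 h18 _]].
rewrite /pot hn // /Phi hr //; congr (_ + _ + _); apply: eq_bigr => i _.
- by apply: eq_bigr => j _; rewrite !hr.
- by rewrite !hr.
- by rewrite !hr.
Qed.

Lemma potential_spec m :
  rmem (sem potential m) 19 0 0 = pot m (rmem m 20 0 0) (nmem m 7 0 0).
Proof.
rewrite /potential.
set t := RMul (RGet 14 _ _) _.
set p1 := For 5 Ln (acc 6 t); set p2 := acc 5 _; set p3 := acc 5 _.
set m1 := rupd m 19%N 0%N 0%N 0.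
rewrite -[sem _ m]/(sem p3 (sem p2 (sem p1 m1))).
have [h1n h1r] := frame p1 m1.
have [h2n h2r] := frame p2 (sem p1 m1).
set s := rmem m 20 0 0; set c := nmem m 7 0 0.
pose pp i := rmem m 15 0 i * (1 + s * rmem m 11 i c).
pose qq i := rmem m 16 0 i * (1 + s * rmem m 12 i c).
have e3 := @acc_spec 5 (penalty 12 16) (sem p2 (sem p1 m1))
  (fun j => - rmem m 18 0 0 * (qq j * qq j)) isT.
rewrite e3; last first.
  by move=> j m' _ [hn hr] /= ->; rewrite !hr // !h2r // !h1r // !hn // !h2n // !h1n //= sub0r.
have e2 := @acc_spec 5 (penalty 11 15) (sem p1 m1)
  (fun j => - rmem m 18 0 0 * (pp j * pp j)) isT.
rewrite e2; last first.
  by move=> j m' _ [hn hr] /= ->; rewrite !hr // !h1r // !hn // !h1n //= sub0r.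
rewrite !h2n // !h1n //; congr (_ + _ + _).
have wp : wf p1 by [].
apply: (@for_inv R (fun N m' => rmem m' 19 0 0 =
  \sum_(i < N) \sum_(j < nmem m 0 0 0) rmem m 14 i j * (pp i * qq j)) 5 Ln (acc 6 t) m1 wp).
  by rewrite big_ord0.
move=> N m' hN [hn hr] hc hI.
rewrite -[LHS]/(rmem (sem (acc 6 t) m') 19 0 0).
rewrite (@acc_spec 6 t m' (fun j => rmem m 14 N j * (pp N * qq j))) //.
  by rewrite hI hn //= big_ord_recr.
move=> j m2 _ [h3n h3r] /= ->.
by rewrite !h3r // !hr // !h3n // hc !hn.
Qed.

Lemma attempt_spec sg m (m' := sem (attempt sg) m) (s := reval m sg)
    (c := nmem m 7 0 0) :
  if 0 < pot m s c then nmem m' 11 0 0 = c /\ rmem m' 21 0 0 = s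
  else nmem m' 11 0 0 = nmem m 11 0 0 /\ rmem m' 21 0 0 = rmem m 21 0 0.
Proof.
rewrite /m' /attempt.
set p := Cond _ _ _.
set m1 := rupd m 20%N 0%N 0%N s.
rewrite -[sem _ m]/(sem p (sem potential m1)).
have ep := potential_spec m1.
have em : pot m1 (rmem m1 20 0 0) (nmem m1 7 0 0) = pot m s c.
  by apply: (@pot_agree [::] [:: 20%N]) => //; apply: agree_rupd.
move: ep; rewrite em => ep.
have [hn hr] := frame potential m1.
move: (sem potential m1) hn hr ep => m2 hn hr ep.
rewrite /p -[sem _ m2]/(if rmem m2 19 0 0 <= 0 then m2 else
  rupd (nupd m2 11%N 0%N 0%N (nmem m2 7 0 0)) 21%N 0%N 0%N (rmem m2 20 0 0)).
rewrite ep ltNge; case: (pot m s c <= 0) => /=; first by rewrite hn // hr.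
by rewrite /upd /= hn // hr.
Qed.

Lemma search_spec m (m' := sem search m) (sg := rmem m 8 0 0) :
  (exists c, [/\ (c < nmem m 1 0 0)%N & 0 < pot m sg c \/ 0 < pot m (- sg) c]) ->
  exists c s, [/\ (c < nmem m 1 0 0)%N, s = sg \/ s = - sg, 0 < pot m s c,
    nmem m' 11 0 0 = c & rmem m' 21 0 0 = s].
Proof.
pose G m' := exists c s, [/\ (c < nmem m 1 0 0)%N, s = sg \/ s = - sg,
  0 < pot m s c, nmem m' 11 0 0 = c & rmem m' 21 0 0 = s].
have wp : wf search by [].
have := @for_inv R (fun N m' =>
  (exists c, [/\ (c < N)%N & 0 < pot m sg c \/ 0 < pot m (- sg) c]) -> G m')
  7 Ld _ m wp.
apply; first by case=> c [].
move=> N m2 hN hm hc hI.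
set p1 := attempt (rc 8); set p2 := attempt (RSub _ _).
rewrite -[incr _ _]/(incr 7%N (sem p2 (sem p1 m2))).
suff hG : (0 < pot m sg N \/ 0 < pot m (- sg) N \/ G m2) ->
    G (sem p2 (sem p1 m2)).
  case=> c; rewrite ltnS leq_eqVlt => -[/predU1P[->|hc'] h].
    have [c' [s [? ? ? ? ?]]] : G (sem p2 (sem p1 m2)) by apply: hG; case: h; auto.
    by exists c', s.
  have [c' [s [? ? ? ? ?]]] : G (sem p2 (sem p1 m2)).
    by apply: hG; right; right; apply: hI; exists c.
  by exists c', s.
have h1 := attempt_spec (rc 8) m2.
have h2 := attempt_spec (RSub (RNat n0) (rc 8)) (sem p1 m2).
cbv zeta in h1, h2; move: h1 h2.
have f1 := frame p1 m2.
have -> x c : pot (sem p1 m2) x c = pot m2 x c by apply: (pot_agree _ _ f1).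
have -> : nmem (sem p1 m2) 7 0 0 = N by rewrite (proj1 f1).
have -> : reval (sem p1 m2) (RSub (RNat n0) (rc 8)) = - sg.
  by rewrite -[LHS]/(0 - rmem (sem p1 m2) 8 0 0) (proj2 f1) // (proj2 hm) // sub0r.
have -> : reval m2 (rc 8) = sg by rewrite -[LHS]/(rmem m2 8 0 0) (proj2 hm).
have e x c : pot m2 x c = pot m x c by apply: (pot_agree _ _ hm).
rewrite hc !e -/p1 -/p2.
case: ifP => h1 [e1 e1']; case: ifP => h2 [e2 e2'].
- by move=> _; exists N, (- sg); split=> //; right.
- by move=> _; exists N, sg; split; rewrite ?e2 ?e2' //; left.
- by move=> _; exists N, (- sg); split=> //; right.
- case=> [//|[//|[c [s [? ? ? ? ?]]]]].
  by exists c, s; split; rewrite ?e2 ?e2' ?e1 ?e1'.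
Qed.

Lemma move_spec m (m' := sem move m) (s := rmem m 21 0 0) (c := nmem m 11 0 0) :
  (forall i, (i < nmem m 0 0 0)%N ->
     rmem m' 15 0 i = rmem m 15 0 i * (1 + s * rmem m 11 i c)) /\
  (forall i, (i < nmem m 0 0 0)%N ->
     rmem m' 16 0 i = rmem m 16 0 i * (1 + s * rmem m 12 i c)).
Proof.
rewrite /m' /move; set p1 := For 5 Ln _; set p2 := For 5 Ln _.
rewrite -[sem _ m]/(sem p2 (sem p1 m)).
have [f1n f1r] := frame p1 m.
have [f2n f2r] := frame p2 (sem p1 m).
split=> i hi.
  rewrite f2r //.
  apply: (map1_spec (f := fun i => rmem m 15 0 i * (1 + s * rmem m 11 i c))) => //.
  move=> {hi}i m2 hi [hn hr] /= ei ew.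
  rewrite ei /upd !eqxx /=; split=> [|i' /negPf -> //].
  by rewrite ew !hr // hn.
apply: (map1_spec (f := fun i => rmem m 16 0 i * (1 + s * rmem m 12 i c))) => //;
  last by rewrite /bound /= f1n.
move=> {hi}i m2 hi [hn hr] /= ei ew.
rewrite ei /upd !eqxx /=; split=> [|i' /negPf -> //].
by rewrite ew !hr // hn // !f1r // f1n.
Qed.

End Specs.

(** * Greedy extraction of a biclique and its trimming to equal sides *)

Section Biclique.
Context (R : realType).
Implicit Types (m : memory R).

Lemma nmap1_spec out a t m (f : nat -> nat) : (1 < a)%N -> (1 < out)%N -> out != a ->
  (forall i m', (i < nmem m 0 0 0)%N -> agree [:: a; out] [::] m m' ->
     nmem m' a 0 0 = i -> nmem m' out 0 i = nmem m out 0 i -> neval m' t = f i) ->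
  forall i, (i < nmem m 0 0 0)%N ->
    nmem (sem (For a Ln (PN out n0 (cell a) t)) m) out 0 i = f i.
Proof.
move=> ha ho hoa h i hi.
have wp : wf (For a Ln (PN out n0 (cell a) t)).
  by rewrite /= ha ho inE eq_sym hoa.
have hao : (a == out) = false by rewrite eq_sym (negPf hoa).
have [|N m' hN hm hc [I1 I2]|h1 _] := @for_inv R (fun N m' =>
  (forall i, i < N -> nmem m' out 0 i = f i)%N /\
  (forall i, N <= i -> nmem m' out 0 i = nmem m out 0 i)%N) a Ln _ m wp.
- by split=> // i' _ /=; rewrite upd_other.
- have e := h N m' hN hm hc (I2 N (leqnn _)).
  split=> i' /= hi'; rewrite upd_other // hc e /upd eqxx /=.
    by move: hi'; rewrite ltnS leq_eqVlt => /predU1P[->|hi']; rewrite ?eqxx // ltn_eqF ?I1.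
  by rewrite gtn_eqF ?I2 // ltnW.
- exact: h1.
Qed.

Lemma sum_card_nat n (A : {set 'I_n}) (f : nat -> nat) :
  (forall j : 'I_n, f j = (j \in A)) -> (\sum_(j < n) f j = #|A|)%N.
Proof.
move=> h; rewrite -sum1_card [RHS]big_mkcond; apply: eq_bigr => j _.
by rewrite h; case: (j \in A).
Qed.

Variables (n : nat) (E : {set 'I_n * 'I_n}).

Definition common (S : {set 'I_n}) : {set 'I_n} :=
  [set j | [forall i in S, (i, j) \in E]].

Lemma commonU1 S i j :
  (j \in common (i |: S)) = ((i, j) \in E) && (j \in common S).
Proof.
rewrite !inE; apply/forall_inP/andP => [h|[h1 /forall_inP h2] i'].
  split; first by apply: h; rewrite !inE eqxx.
  by apply/forall_inP => i' hi'; apply: h; rewrite !inE hi' orbT.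
by rewrite !inE => /predU1P[->|] //; apply: h2.
Qed.

Definition bad m (i : 'I_n) : R :=
  \sum_(j < n) (1 - nmem m 2 i j)%:R * rmem m 16 0 j.

Definition good m : {set 'I_n} :=
  [set i | rmem m 17 0 0 * bad m i <= 2 * \sum_(j < n) rmem m 16 0 j].

(** Since the program ignores the target, the last clause must hold for every [s]. Suppose a good
    [i] is rejected while [#|S| < s]. Then [i |: S] has at most [s] elements, hence at least [s]
    common neighbours, more than [#|S|], and the test would have accepted it. So either [#|S|]
    reaches [s] or [S] ends up with all good vertices. *)
Lemma extract_spec m (m' := sem extract m) :
  nmem m 0 0 0 = n -> (forall i j : 'I_n, nmem m 2 i j = ((i, j) \in E)) ->
  (forall i : 'I_n, nmem m 3 0 i = 0%N) -> nmem m 12 0 0 = 0%N ->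
  exists S : {set 'I_n},
  [/\ forall i : 'I_n, nmem m' 3 0 i = (i \in S),
      forall j : 'I_n, nmem m' 4 0 j = (j \in common S),
      nmem m' 12 0 0 = #|S|,
      (#|S| <= #|common S|)%N &
      forall s : nat, (s <= #|good m|)%N ->
        (forall S' : {set 'I_n}, S' \subset good m -> (#|S'| <= s)%N ->
           (s <= #|common S'|)%N) -> (s <= #|S|)%N].
Proof.
move=> en eE e3 e12; rewrite /m' /extract.
set p1 := rsum 22 _ _ _ _ _; set p2 := For 5 Ln (PN 4 _ _ _).
set q1 := rsum 23 _ _ _ _ _; set q3 := For 6 Ln (PN 13 _ _ _).
set q4 := Cond _ _ _; set q := q1 ;; _.
rewrite -[sem _ m]/(sem (For 5 Ln q) (sem p2 (sem p1 m))).
have f1 := frame p1 m; have f2 := frame p2 (sem p1 m).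
have hB : rmem (sem p1 m) 22 0 0 = \sum_(j < n) rmem m 16 0 j.
  rewrite (@rsum_spec R 22 n0 n0 5 Ln (RGet 16 n0 vi) m 0 0 (fun j => rmem m 16 0 j)) //.
    by rewrite /bound /= en.
  by move=> j m2 _ [_ h2] /= ->; rewrite h2.
have hT (j : 'I_n) : nmem (sem p2 (sem p1 m)) 4 0 j = 1%N.
  apply: (@nmap1_spec 4 5 n1 (sem p1 m) (fun=> 1%N)) => //.
  by rewrite (proj1 f1) // en.
set m2 := sem p2 (sem p1 m) in hT *.
have g2n a i j : a \notin [:: 4; 5]%N -> nmem m2 a i j = nmem m a i j.
  move=> ha; rewrite (proj1 f2) ?(proj1 f1) //;
  by apply: contra ha; rewrite /= !inE; lia.
have g2r a i j : a \notin [:: 22]%N -> rmem m2 a i j = rmem m a i j.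
  by move=> ha; rewrite (proj2 f2) // (proj2 f1) //; apply: contra ha; rewrite /= !inE; lia.
have {}hB : rmem m2 22 0 0 = \sum_(j < n) rmem m 16 0 j by rewrite (proj2 f2).
(* The last clause is the dichotomy for the vertices met so far: [s] is reached, or no good vertex
   has been rejected. *)
pose P N m' := exists S : {set 'I_n},
  [/\ forall i : 'I_n, nmem m' 3 0 i = (i \in S),
      forall j : 'I_n, nmem m' 4 0 j = (j \in common S),
      nmem m' 12 0 0 = #|S|,
      (#|S| <= #|common S|)%N /\ S \subset [set i in good m | (i < N)%N] &
      forall s : nat,
        (forall S' : {set 'I_n}, S' \subset good m -> (#|S'| <= s)%N ->
           (s <= #|common S'|)%N) ->
        (s <= #|S|)%N \/ S = [set i in good m | (i < N)%N]].
have wq : wf (For 5 Ln q) by [].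
suff : P (bound Ln m2) (sem (For 5 Ln q) m2).
  have -> : bound Ln m2 = n by rewrite /bound /= g2n.
  case=> S [h1 h2 h3 [h4 _] h5]; exists S; split=> // s hs /h5[//|->].
  apply: leq_trans hs _; apply: subset_leq_card; apply/fintype.subsetP => i hi.
  by rewrite inE hi ltn_ord.
apply: (@for_inv R P 5 Ln q m2 wq).
  exists finset.set0; split=> /=.
  - by move=> i; rewrite /upd /= g2n // e3 inE.
  - move=> j; rewrite /upd /= hT inE.
    by case: forall_inP => // -[] i; rewrite inE.
  - by rewrite /upd /= g2n // cards0.
  - by rewrite cards0 finset.sub0set.
  - by move=> s _; right; apply/setP => i; rewrite !inE ltn0 andbF.
move=> N m3 hN hm hc [S [h1 h2 h3 [h4 hS] h5]].
have hNn : (N < n)%N by move: hN; rewrite /bound /= g2n // en.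
pose i := Ordinal hNn.
have hm' a x y : a \notin [:: 5; 13; 6; 3; 12; 4]%N -> nmem m3 a x y = nmem m2 a x y.
  move=> ha; apply: (proj1 hm); apply: contra ha => /=.
  by rewrite !inE; lia.
have hmr a x y : a \notin [:: 23; 22]%N -> rmem m3 a x y = rmem m a x y.
  move=> ha; rewrite (proj2 hm) ?g2r //;
  by apply: contra ha; rewrite /= !inE; lia.
rewrite -[incr _ _]/(incr 5%N (sem q4 (sem q3 (nupd (sem q1 m3) 13%N 0%N 0%N 0%N)))).
have k1 := frame q1 m3.
have hnq : rmem (sem q1 m3) 23 0 0 = bad m i.
  rewrite (@rsum_spec R 23 n0 n0 6 Ln _ m3 0 0
    (fun j => (1 - nmem m 2 i j)%:R * rmem m 16 0 j)) //.
    by rewrite /bound /= hm' // g2n // en.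
  by move=> j m4 _ [h4n h4r] /= ->; rewrite !h4n // hc hm' // g2n // h4r // hmr.
set m4 := nupd _ 13%N _ _ _.
have k3 := frame q3 m4.
have wq3 : wf q3 by [].
have hcnt : nmem (sem q3 m4) 13 0 0 = #|common (i |: S)|.
  have e4 : bound Ln m4 = n.
    by rewrite -[LHS]/(nmem (sem q1 m3) 0 0 0) (proj1 k1) // hm' // g2n.
  (* On 0-1 values this truncated difference is a conjunction. *)
  pose t j := (nmem m3 4 0 j - (1 - nmem m 2 N j))%N.
  rewrite -(@sum_card_nat n _ t); last first.
    move=> j; rewrite /t h2 (eE i j) commonU1.
    by case: (_ \in E); case: (_ \in _).
  have h := @for_inv R (fun j m' =>
    nmem m' 13 0 0 = \sum_(j' < j) t j')%N 6 Ln _ m4 wq3.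
  rewrite e4 in h; apply: h.
    by rewrite big_ord0.
  move=> j m5 hj [h5n h5r] ej hI.
  have k4 a x y : a \notin [:: 13; 23; 6]%N -> nmem m4 a x y = nmem m3 a x y.
    move=> ha; rewrite -[LHS]/(upd (nmem (sem q1 m3)) 13%N 0%N 0%N 0%N a x y).
    rewrite upd_other; last by apply: contra ha => /eqP ->.
    by rewrite (proj1 k1) //; apply: contra ha; rewrite /= !inE; lia.
  rewrite /= /upd /= hI big_ord_recr /= /t ej; congr (_ + (_ - (_ - _)))%N.
    by rewrite h5n // k4.
  by rewrite !h5n // !k4 // hc hm' // g2n.
set m5 := sem q3 m4 in k3 hcnt *.
have g5n a x y : a \notin [:: 6; 13]%N -> nmem m5 a x y = nmem m3 a x y.
  move=> ha; rewrite (proj1 k3); last first.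
    by apply: contra ha; rewrite /= !inE; lia.
  rewrite -[LHS]/(upd (nmem (sem q1 m3)) 13%N 0%N 0%N 0%N a x y).
  rewrite upd_other; last by apply: contra ha => /eqP ->.
  by rewrite (proj1 k1) //; apply: contra ha; rewrite /= !inE; lia.
have g5r a x y : a \notin [:: 23; 22]%N -> rmem m5 a x y = rmem m a x y.
  move=> ha; rewrite (proj2 k3) // (proj2 k1) ?hmr //.
  by apply: contra ha; rewrite /= !inE; lia.
have e22 : rmem m5 22 0 0 = \sum_(j < n) rmem m 16 0 j.
  by rewrite (proj2 k3) // (proj2 k1) // (proj2 hm).
have e23 : rmem m5 23 0 0 = bad m i by rewrite (proj2 k3).
have -> : sem q4 m5 = if (i \in good m) && (#|S| < #|common (i |: S)|)%N
    then sem shrink m5 else m5.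
  rewrite -[LHS]/(if (rmem m5 17 0 0 * rmem m5 23 0 0 <= 2%:R * rmem m5 22 0 0) &&
    (nmem m5 12 0 0 + 1 <= nmem m5 13 0 0)%N then sem shrink m5 else m5).
  by rewrite g5r // e23 e22 hcnt g5n // h3 addn1 inE.
have hiS : i \notin S.
  by apply/negP => /(fintype.subsetP hS); rewrite !inE ltnn andbF.
have hsub : S \subset [set i0 in good m | (i0 < N.+1)%N].
  apply/fintype.subsetP => i' /(fintype.subsetP hS); rewrite !inE => /andP[-> /ltnW].
  by rewrite ltnS.
have hstep : [set i0 in good m | (i0 < N.+1)%N] =
    if i \in good m then i |: [set i0 in good m | (i0 < N)%N]
    else [set i0 in good m | (i0 < N)%N].
  move: (good m) => G; apply/setP => i'; rewrite finset.in_set ltnS leq_eqVlt andb_orr.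
  have -> : (nat_of_ord i' == N) = (i' == i) by [].
  case: ifP => hg; rewrite ?finset.in_setU1 ?finset.in_set.
    by case: eqP => [->|]; rewrite ?hg ?andbF ?andbT.
  by case: eqP => [->|]; rewrite ?hg ?andbF.
case: ifP => [/andP[hg hlt]|hno]; last first.
  exists S; split=> //=.
  - by move=> j; rewrite upd_other // g5n.
  - by move=> j; rewrite upd_other // g5n.
  - by rewrite upd_other // g5n.
  - move=> s hs; case: (h5 s hs) => [|e]; first by left.
    rewrite hstep; move: hno; case: ifP => /= hg; last by right.
    move/negbT; rewrite -leqNgt => hle; left; rewrite leqNgt; apply/negP => hlt.
    have : (s <= #|common (i |: S)|)%N.
      apply: hs; last by rewrite cardsU1 hiS.
      apply/fintype.subsetP => i'; rewrite finset.in_setU1 => /predU1P[->//|/(fintype.subsetP hS)].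
      by rewrite finset.in_set => /andP[].
    by move=> h; move: (leq_trans hlt (leq_trans h hle)); rewrite ltnn.
set q5 := For 6 Ln (PN 4 n0 vj (NSub (NGet 4 n0 vj) (NSub n1 (NGet 2 vi vj)))).
set m6 := nupd (nupd m5 3%N 0%N N 1%N) 12%N 0%N 0%N #|S|.+1.
have -> : sem shrink m5 = sem q5 m6.
  rewrite -[LHS]/(sem q5 (nupd (nupd m5 3%N 0%N (nmem m5 5 0 0) 1%N) 12%N 0%N 0%N
    (upd (nmem m5) 3%N 0%N (nmem m5 5 0 0) 1%N 12%N 0%N 0%N + 1)%N)).
  by rewrite upd_other // !g5n // hc h3 addn1.
have f6 := frame q5 m6.
exists (i |: S); split.
- move=> i'; rewrite -[LHS]/(nmem (sem q5 m6) 3 0 i') (proj1 f6) //.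
  rewrite /= /upd /= finset.in_setU1 -[i' == i]/(nat_of_ord i' == N).
  by case: eqP => //= _; rewrite g5n.
- move=> j; rewrite -[LHS]/(nmem (sem q5 m6) 4 0 j).
  have -> : nat_of_bool (j \in common (i |: S)) =
      (nmem m3 4 0 j - (1 - nmem m 2 N j))%N.
    by rewrite h2 (eE i j) commonU1; case: (_ \in E); case: (_ \in _).
  apply: (@nmap1_spec 4 6 _ m6 (fun j => nmem m3 4 0 j - (1 - nmem m 2 N j))%N) => //=.
  + move=> j' m7 _ [h7n h7r] ej ew.
    by rewrite ej ew !h7n // /m6 /= /upd /= !g5n // hc (hm' 2%N) // g2n.
  + by rewrite !upd_other // g5n // hm' // g2n // en.
- by rewrite cardsU1 hiS -[LHS]/(nmem (sem q5 m6) 12 0 0) (proj1 f6).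
- split; first by rewrite cardsU1 hiS.
  apply/fintype.subsetP => i'; rewrite finset.in_setU1 => /predU1P[->|/(fintype.subsetP hsub)//].
  by rewrite finset.in_set hg /=.
- move=> s /h5[h|h]; first by left; rewrite cardsU1 hiS (leq_trans h).
  by right; rewrite hstep hg -h.
Qed.

Lemma balance_spec m (m' := sem balance m) (T : {set 'I_n}) :
  nmem m 0 0 0 = n -> (forall j : 'I_n, nmem m 4 0 j = (j \in T)) ->
  (nmem m 12 0 0 <= #|T|)%N ->
  exists T' : {set 'I_n}, [/\ forall j : 'I_n, nmem m' 4 0 j = (j \in T'),
    T' \subset T & #|T'| = nmem m 12 0 0].
Proof.
move=> en eT hle; rewrite /m' /balance; set p := For 5 Ln _.
set m1 := nupd m 13%N 0%N 0%N 0%N; rewrite -[sem _ m]/(sem p m1).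
(* Either the quota is met or nothing has been dropped yet; as [T] is at least as large as the
   quota, both cases end with the right size. *)
pose P N m' := exists T' : {set 'I_n},
  [/\ forall j : 'I_n, nmem m' 4 0 j = (if (j < N)%N then j \in T' else j \in T),
      T' \subset [set j in T | (j < N)%N], nmem m' 13 0 0 = #|T'|,
      (#|T'| <= nmem m 12 0 0)%N &
      #|T'| = nmem m 12 0 0 \/ T' = [set j in T | (j < N)%N]].
have wp : wf p by [].
suff : P (bound Ln m1) (sem p m1).
  have -> : bound Ln m1 = n by [].
  case=> T' [h1 h2 h3 h4 h5]; exists T'; split=> //.
  - by move=> j; rewrite h1 ltn_ord.
  - by apply: fintype.subset_trans h2 _; apply/fintype.subsetP => j; rewrite finset.in_set => /andP[].
  - case: h5 => // e; apply/eqP; rewrite eqn_leq h4 e (leq_trans hle) //.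
    by apply: subset_leq_card; apply/fintype.subsetP => j hj; rewrite finset.in_set hj ltn_ord.
apply: (@for_inv R P 5 Ln _ m1 wp).
  exists finset.set0; split=> //=.
  - by rewrite finset.sub0set.
  - by rewrite /upd /= cards0.
  - by rewrite cards0.
  - by right; apply/setP => i; rewrite !inE ltn0 andbF.
move=> N m2 hN [hn hr] hc [T' [h1 h2 h3 h4 h5]].
have hNn : (N < n)%N by move: hN; rewrite -[bound Ln m1]/(nmem m 0 0 0) en.
pose i := Ordinal hNn.
have hiT : i \notin T'.
  by apply/negP => /(fintype.subsetP h2); rewrite !inE ltnn andbF.
have e4 : nmem m2 4 0 N = (i \in T) by rewrite (h1 i) ltnn.
have e12 : nmem m2 12 0 0 = nmem m 12 0 0 by rewrite hn.
set pb := Cond _ _ _.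
have -> : sem pb m2 = if (i \in T) && (#|T'| < nmem m 12 0 0)%N
    then nupd m2 13%N 0%N 0%N #|T'|.+1 else nupd m2 4%N 0%N N 0%N.
  rewrite -[LHS]/(if (1 <= nmem m2 4 0 (nmem m2 5 0 0))%N &&
     (nmem m2 13 0 0 + 1 <= nmem m2 12 0 0)%N
    then nupd m2 13%N 0%N 0%N (nmem m2 13 0 0 + 1)%N
    else nupd m2 4%N 0%N (nmem m2 5 0 0) 0%N).
  by rewrite hc e4 h3 e12 addn1 lt0b.
have hstep : [set j in T | (j < N.+1)%N] =
    if i \in T then i |: [set j in T | (j < N)%N] else [set j in T | (j < N)%N].
  apply/setP => i'; rewrite finset.in_set ltnS leq_eqVlt andb_orr.
  have -> : (nat_of_ord i' == N) = (i' == i) by [].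
  case: ifP => hg; rewrite ?finset.in_setU1 ?finset.in_set.
    by case: eqP => [->|]; rewrite ?hg ?andbF ?andbT.
  by case: eqP => [->|]; rewrite ?hg ?andbF.
have hsub : T' \subset [set j in T | (j < N.+1)%N].
  apply/fintype.subsetP => i' /(fintype.subsetP h2); rewrite !inE => /andP[-> /ltnW].
  by rewrite ltnS.
case: ifP => [/andP[hg hlt]|hno].
  exists (i |: T'); split=> /=.
  - move=> j; rewrite !upd_other // h1 finset.in_setU1 -[j == i]/(nat_of_ord j == N) (ltnS j N) (leq_eqVlt j N).
    case: eqP => [e|_] //=; have -> : j = i by apply: val_inj.
    by rewrite ltnn hg.
  - apply/fintype.subsetP => i'; rewrite finset.in_setU1 => /predU1P[->|/(fintype.subsetP hsub)//].
    by rewrite finset.in_set hg /=.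
  - by rewrite /upd /= cardsU1 hiT.
  - by rewrite cardsU1 hiT.
  - case: h5 => [e|->]; last by right; rewrite hstep hg.
    by move: hlt; rewrite e ltnn.
exists T'; split=> //=.
- move=> j; rewrite upd_other // /upd /= (ltnS j N) (leq_eqVlt j N).
  case: eqP => [e|_] /=; last exact: h1.
  by have -> : j = i by [apply: val_inj]; rewrite (negPf hiT).
- case: h5 => [e|e]; first by left.
  move: hno; rewrite hstep; case: ifP => /= hg; last by right.
  by move/negbT; rewrite -leqNgt => hle'; left; apply/eqP; rewrite eqn_leq h4.
Qed.

End Biclique.

(** * The potential *)

Section Potential.
Context (R : realType).

Lemma bernoulli (z : R) T : 0 <= z -> 1 + T%:R * (z - 1) <= z ^+ T.
Proof.
move=> z0; elim: T => [|T IH]; first by rewrite mul0r addr0 expr0.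
rewrite exprS; apply: le_trans (ler_wpM2l z0 IH).
rewrite -subr_ge0 (_ : _ - _ = T%:R * (z - 1) ^+ 2); last by rewrite -natr1; ring.
by rewrite mulr_ge0 // sqr_ge0.
Qed.

(* Summed over the 2d candidate moves, the potential is at least 2 d beta times
   its former value. *)
Lemma potential_step n d (W M x y : nat -> nat -> R) (L s eps r beta : R)
    (p q : nat -> R) :
  (0 < d)%N -> eps = s * s / d%:R -> 0 <= eps -> 0 < beta -> 0 <= L -> 0 <= r ->
  (forall i j, (i < n)%N -> (j < n)%N -> M i j = \sum_(c < d) x i c * y j c) ->
  (forall i, (i < n)%N -> p i != 0 -> \sum_(c < d) x i c * x i c <= r) ->
  (forall j, (j < n)%N -> q j != 0 -> \sum_(c < d) y j c * y j c <= r) ->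
  (forall i j, (i < n)%N -> (j < n)%N -> p i != 0 -> q j != 0 ->
     0 < 1 + eps * M i j) ->
  0 < Phi n W L p q ->
  let W' i j := W i j / ((1 + eps * M i j) / beta) in
  let L' := L * (beta / (1 + eps * r)) in
  let F s c := Phi n W' L' (fun i => p i * (1 + s * x i c))
                 (fun j => q j * (1 + s * y j c)) in
  exists c, [/\ (c < d)%N & 0 < F s c \/ 0 < F (- s) c].
Proof.
move=> d0 epsE eps0 b0 L0 r0 ME px qy pos Phi0 W' L' F.
have dR : 0 < d%:R :> R by rewrite ltr0n.
have sE : s * s = eps * d%:R by rewrite epsE; field; rewrite gt_eqF.
(* If every move gave a nonpositive value, so would their sum, which is then computed. *)
apply: contrapT => hno.
have hle (c : 'I_d) : F s c + F (- s) c <= 0.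
  rewrite -[0]addr0 lerD // leNgt; apply/negP => h; apply: hno; exists c; split=> //.
    by left.
  by right.
have {hno hle} : \sum_(c < d) (F s c + F (- s) c) <= 0.
  by rewrite sumr_le0.
apply/negP; rewrite -ltNge.
apply: (@lt_le_trans _ _ (2 * d%:R * beta * Phi n W L p q)); first by rewrite !mulr_gt0.
have er0 : 0 < 1 + eps * r by rewrite ltr_wpDr // mulr_ge0.
(* Pairing the two signs of [s] cancels the terms of odd degree in [s]. *)
pose A1 c := \sum_(i < n) \sum_(j < n) W' i j *
   ((p i * (1 + s * x i c)) * (q j * (1 + s * y j c)) +
    (p i * (1 + (- s) * x i c)) * (q j * (1 + (- s) * y j c))).
pose A2 c := \sum_(i < n) - L' *
   ((p i * (1 + s * x i c)) * (p i * (1 + s * x i c)) +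
    (p i * (1 + (- s) * x i c)) * (p i * (1 + (- s) * x i c))).
pose A3 c := \sum_(i < n) - L' *
   ((q i * (1 + s * y i c)) * (q i * (1 + s * y i c)) +
    (q i * (1 + (- s) * y i c)) * (q i * (1 + (- s) * y i c))).
have eF c : F s c + F (- s) c = A1 c + A2 c + A3 c.
  rewrite /F /Phi /A1 /A2 /A3 addrACA (addrACA (\sum_(i < n) _)); congr (_ + _ + _).
  - rewrite -big_split; apply: eq_bigr => i _ /=.
    by rewrite -big_split; apply: eq_bigr => j _ /=; rewrite -mulrDr.
  - by rewrite -big_split; apply: eq_bigr => j _ /=; rewrite -mulrDr.
  - by rewrite -big_split; apply: eq_bigr => j _ /=; rewrite -mulrDr.
under eq_bigr => c _ do rewrite eF.
have hsum (z w : nat -> R) : \sum_(c < d) (1 + s * s * (z c * w c)) =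
    d%:R * (1 + eps * \sum_(c < d) z c * w c).
  rewrite big_split /= sumr_const card_ord -mulr_sumr sE.
  by rewrite mulrDr mulr1 mulrA (mulrC eps).
have h1 : \sum_(c < d) A1 c = \sum_(i < n) \sum_(j < n)
    2 * d%:R * beta * (W i j * (p i * q j)).
  rewrite /A1 exchange_big; apply: eq_bigr => i _.
  rewrite exchange_big; apply: eq_bigr => j _ /=.
  have [->|pi] := eqVneq (p i) 0; first by rewrite big1 => [|c _]; ring.
  have [->|qj] := eqVneq (q j) 0; first by rewrite big1 => [|c _]; ring.
  rewrite (eq_bigr (fun c : 'I_d => W' i j * (p i * q j) * 2 *
     (1 + s * s * (x i c * y j c)))); last by move=> c _; ring.
  rewrite -mulr_sumr hsum -ME // /W'.
  have h := pos i j (ltn_ord i) (ltn_ord j) pi qj.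
  by field; rewrite !gt_eqF.
(* For the penalties only an inequality holds, since the squared norms are merely bounded by [r];
   the new [L'] makes it tight at norm exactly [r]. *)
have hpen (z : nat -> nat -> R) (w : nat -> R) i : (i < n)%N ->
    (w i != 0 -> \sum_(c < d) z i c * z i c <= r) ->
    2 * d%:R * beta * (- L * (w i * w i)) <= \sum_(c < d) - L' *
      (w i * (1 + s * z i c) * (w i * (1 + s * z i c)) +
       w i * (1 + (- s) * z i c) * (w i * (1 + (- s) * z i c))).
  move=> hi hz; have [->|wi] := eqVneq (w i) 0.
    by rewrite big1 => [|c _]; [rewrite !mul0r !mulr0|ring].
  rewrite (eq_bigr (fun c : 'I_d => - L' * (w i * w i) * 2 *
     (1 + s * s * (z i c * z i c)))); last by move=> c _; ring.
  rewrite -mulr_sumr hsum.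
  rewrite (_ : 2 * _ * _ * _ = - (L' * (w i * w i) * 2 * (d%:R * (1 + eps * r)))); last first.
    by rewrite /L'; field; rewrite gt_eqF.
  rewrite !mulNr lerN2; apply: ler_wpM2l.
    have L'0 : 0 <= L' by rewrite /L' mulr_ge0 // divr_ge0 // ltW.
    by rewrite mulr_ge0 // mulr_ge0 // -expr2 sqr_ge0.
  by rewrite ler_wpM2l ?ler0n // lerD2l ler_wpM2l ?hz.
have h2 : \sum_(i < n) 2 * d%:R * beta * (- L * (p i * p i)) <= \sum_(c < d) A2 c.
  rewrite /A2 exchange_big; apply: ler_sum => i _; apply: (hpen x p) => // h.
  exact: px.
have h3 : \sum_(i < n) 2 * d%:R * beta * (- L * (q i * q i)) <= \sum_(c < d) A3 c.
  rewrite /A3 exchange_big; apply: ler_sum => i _; apply: (hpen y q) => // h.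
  exact: qy.
rewrite 2!big_split /= h1 /Phi !mulrDr !lerD //.
- rewrite mulr_sumr; apply: ler_sum => i _; by rewrite mulr_sumr.
- by rewrite mulr_sumr.
- by rewrite mulr_sumr.
Qed.

Definition truncate (r : R) (a : nat -> R) (i : nat) : R :=
  if 1 <= r * a i then a i else 0.

(** Each of the at most [n] dropped entries is below [1 / r = k / (4 n)]. *)
Lemma sum_truncate n (a : nat -> R) k (r := 4 * n%:R / k) :
  0 < k -> (0 < n)%N -> (forall i, (i < n)%N -> 0 <= a i) ->
  \sum_(i < n) (a i - truncate r a i) <= k / 4.
Proof.
move=> k0 n0 ha.
have nR : 0 < n%:R :> R by rewrite ltr0n.
apply: (@le_trans _ _ (\sum_(i < n) (k / 4 / n%:R))); last first.
  rewrite sumr_const card_ord -mulr_natr le_eqVlt; apply/orP; left; apply/eqP.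
  by field; rewrite gt_eqF.
apply: ler_sum => i _; rewrite /truncate; case: ifP => [_|/negbT].
  by rewrite subrr !divr_ge0 // ltW.
rewrite -ltNge subr0 => h.
rewrite -(ler_pM2l (_ : 0 < r)); last by rewrite /r divr_gt0 // mulr_gt0.
apply: le_trans (ltW h) _; rewrite le_eqVlt; apply/orP; left; apply/eqP.
by rewrite /r; field; rewrite !gt_eqF.
Qed.

(** Bernoulli's inequality replaces the power by its linear part, so only the average of
    [M i j + 1 / 2] for the truncated weights matters, whatever [T] is. Once this average is
    nonnegative, the first term is at least half the product of the total weights, each at least
    [3 k / 4]. *)
Lemma potential_init n T (a b : nat -> R) (st M : nat -> nat -> R)
    (ne : nat -> nat -> nat) (k eps : R) (r := 4 * n%:R / k)
    (beta := 1 - eps / 2) (p := truncate r a) (q := truncate r b) :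
  (0 < n)%N -> 0 < k -> 0 <= eps <= 1 ->
  (forall i, (i < n)%N -> 0 <= a i <= 1) -> (forall i, (i < n)%N -> 0 <= b i <= 1) ->
  (forall i j, (i < n)%N -> (j < n)%N -> 0 <= st i j) ->
  \sum_(i < n) a i = k -> \sum_(i < n) b i = k ->
  (forall i, (i < n)%N -> \sum_(j < n) st i j = k * a i) ->
  (forall j, (j < n)%N -> \sum_(i < n) st i j = k * b j) ->
  (forall i j, (i < n)%N -> (j < n)%N -> a i != 0 -> b j != 0 ->
     M i j = st i j / (a i * b j) - 1) ->
  (forall i j, (i < n)%N -> (j < n)%N -> (ne i j <= 1)%N) ->
  0 < Phi n (fun i j => ((1 + eps * M i j) / beta) ^+ T - (ne i j)%:R / 2)
        (k / 16) p q.
Proof.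
move=> n0 k0 /andP[e0 e1] ha hb hst sa sb sta stb hM hne.
have b0 : 0 < beta by rewrite /beta; lra.
have ha0 i : (i < n)%N -> 0 <= a i by move=> /ha /andP[].
have hb0 i : (i < n)%N -> 0 <= b i by move=> /hb /andP[].
have htr (f : nat -> R) i : 0 <= f i -> 0 <= truncate r f i <= f i.
  by rewrite /truncate; case: ifP => _ h; rewrite ?h lexx.
have hp (i : 'I_n) : 0 <= p i <= a i by apply/htr/ha0.
have hq (i : 'I_n) : 0 <= q i <= b i by apply/htr/hb0.
set Ap := \sum_(i < n) p i; set Bq := \sum_(i < n) q i.
have hAB (f : nat -> R) : \sum_(i < n) f i = k -> (forall i, (i < n)%N -> 0 <= f i) ->
    3 / 4 * k <= \sum_(i < n) truncate r f i <= k.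
  move=> sf f0; have := sum_truncate k0 n0 f0; rewrite sumrB sf -/r => h.
  have -> /= : 3 / 4 * k <= \sum_(i < n) truncate r f i by lra.
  by rewrite -sf; apply: ler_sum => i _; have /andP[] := htr f i (f0 i (ltn_ord i)).
have /andP[A1 A2] : 3 / 4 * k <= Ap <= k by apply: hAB.
have /andP[B1 B2] : 3 / 4 * k <= Bq <= k by apply: hAB.
have hsq (f : nat -> R) : (forall i, (i < n)%N -> 0 <= f i <= 1) ->
    \sum_(i < n) truncate r f i * truncate r f i <= \sum_(i < n) truncate r f i.
  move=> f01; apply: ler_sum => i _; have /andP[f0 f1] := f01 i (ltn_ord i).
  have /andP[t0 t1] := htr f i f0.
  by rewrite ler_piMr // (le_trans t1).
(* On kept pairs [(M i j + 1) * (p i * q j)] is [st i j]. The total of [st] is [k ^ 2]; the dropped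
   rows and the dropped columns remove at most [k ^ 2 / 4] each, and the remaining [k ^ 2 / 2] pays
   for half of the product of the weights. This fixes the 4 in [r] and the 1/2 in [beta]. *)
have hcorr : 0 <= \sum_(i < n) \sum_(j < n) (M i j + 1 / 2) * (p i * q j).
  pose ua i := ~~ (1 <= r * a i); pose ub j := ~~ (1 <= r * b j).
  have hpt (i j : 'I_n) : st i j - st i j * (ua i)%:R - st i j * (ub j)%:R
      - p i * q j / 2 <= (M i j + 1 / 2) * (p i * q j).
    have s0 := hst i j (ltn_ord i) (ltn_ord j).
    rewrite /p /q /truncate /ua /ub; case: ifP => ha1; last first.
      by case: ifP => _; rewrite !mul0r !mulr0 ?mulr1; lra.
    case: ifP => hb1; last by rewrite !mulr0 ?mulr1 mul0r; lra.
    have a0 : a i != 0.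
      by apply: contraTneq ha1 => ->; rewrite mulr0 ler10.
    have b0' : b j != 0.
      by apply: contraTneq hb1 => ->; rewrite mulr0 ler10.
    rewrite hM // !mulr0 !subr0 le_eqVlt; apply/orP; left; apply/eqP.
    by field; rewrite a0 b0'.
  apply: le_trans (ler_sum _ (fun i _ => ler_sum _ (fun j _ => hpt i j))).
  have hcut (f : nat -> R) : \sum_(i < n) f i = k -> (forall i, (i < n)%N -> 0 <= f i) ->
      \sum_(i < n) f i * (~~ (1 <= r * f i))%:R <= k / 4.
    move=> sf f0; apply: le_trans (sum_truncate k0 n0 f0).
    apply: ler_sum => i _; rewrite -/r /truncate; case: ifP => _ /=.
      by rewrite mulr0 subrr.
    by rewrite mulr1 subr0.
  have c1 : \sum_(i < n) \sum_(j < n) st i j = k * k.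
    under eq_bigr => i _ do rewrite sta //.
    by rewrite -mulr_sumr sa.
  have c2 : \sum_(i < n) \sum_(j < n) st i j * (ua i)%:R <= k * (k / 4).
    under eq_bigr => i _ do rewrite -mulr_suml sta // -mulrA.
    by rewrite -mulr_sumr ler_wpM2l ?hcut // ltW.
  have c3 : \sum_(i < n) \sum_(j < n) st i j * (ub j)%:R <= k * (k / 4).
    rewrite exchange_big /=; under eq_bigr => j _ do rewrite -mulr_suml stb // -mulrA.
    by rewrite -mulr_sumr ler_wpM2l ?hcut // ltW.
  have c4 : \sum_(i < n) \sum_(j < n) p i * q j / 2 <= k * k / 2.
    under eq_bigr => i _ do rewrite -mulr_suml -mulr_sumr.
    rewrite -!mulr_suml ler_wpM2r // ler_pM //.
      by apply: sumr_ge0 => i _; have /andP[] := hp i.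
    by apply: sumr_ge0 => i _; have /andP[] := hq i.
  rewrite (_ : \sum_(i < n) _ = \sum_(i < n) \sum_(j < n) st i j -
    \sum_(i < n) \sum_(j < n) st i j * (ua i)%:R -
    \sum_(i < n) \sum_(j < n) st i j * (ub j)%:R -
    \sum_(i < n) \sum_(j < n) p i * q j / 2); last first.
    by rewrite -!sumrB; apply: eq_bigr => i _; rewrite -!sumrB.
  by rewrite c1; lra.
have hmain : Ap * Bq / 2 <= \sum_(i < n) \sum_(j < n)
    (((1 + eps * M i j) / beta) ^+ T - (ne i j)%:R / 2) * (p i * q j).
  (* Since [beta = 1 - eps / 2], the growth factor minus 1 is [eps / beta * (M i j + 1 / 2)]; the
     loss of at most 1/2 on a non-edge leaves the other half. *)
  have hpt (i j : 'I_n) : p i * q j / 2 +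
      (T%:R * eps / beta) * ((M i j + 1 / 2) * (p i * q j)) <=
      (((1 + eps * M i j) / beta) ^+ T - (ne i j)%:R / 2) * (p i * q j).
    have /andP[p0 pa] := hp i; have /andP[q0 qb] := hq j.
    have [pz|pi] := eqVneq (p i) 0; first by rewrite pz !(mul0r, mulr0) addr0.
    have [qz|qj] := eqVneq (q j) 0; first by rewrite qz !(mul0r, mulr0) addr0.
    have ai : 0 < a i by apply: lt_le_trans pa; rewrite lt_def pi.
    have bj : 0 < b j by apply: lt_le_trans qb; rewrite lt_def qj.
    have Mge : -1 <= M i j.
      rewrite hM ?gt_eqF // lerBrDr addNr divr_ge0 ?hst //.
      by rewrite mulr_ge0 // ltW.
    have hM1 : 0 <= eps * (M i j + 1) by rewrite mulr_ge0 // -lerBlDr sub0r.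
    have z0 : 0 <= (1 + eps * M i j) / beta by rewrite divr_ge0 ?(ltW b0) //; lra.
    have hB := bernoulli T z0.
    have hn : (ne i j)%:R <= 1 :> R by rewrite lern1 hne.
    rewrite -subr_ge0 (_ : _ - _ = p i * q j *
      ((((1 + eps * M i j) / beta) ^+ T - (1 + T%:R * ((1 + eps * M i j) / beta - 1)))
       + (1 - (ne i j)%:R) / 2)); last first.
      by rewrite /beta; field; rewrite -/beta gt_eqF // /beta; lra.
    rewrite mulr_ge0 ?mulr_ge0 // addr_ge0 ?subr_ge0 // divr_ge0 // subr_ge0 //.
  apply: le_trans (ler_sum _ (fun i _ => ler_sum _ (fun j _ => hpt i j))).
  rewrite (_ : \sum_(i < n) _ = \sum_(i < n) \sum_(j < n) p i * q j / 2 +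
    (T%:R * eps / beta) * \sum_(i < n) \sum_(j < n) (M i j + 1 / 2) * (p i * q j)); last first.
    rewrite mulr_sumr -big_split; apply: eq_bigr => i _ /=.
    by rewrite mulr_sumr -big_split.
  rewrite (_ : \sum_(i < n) \sum_(j < n) p i * q j / 2 = Ap * Bq / 2); last first.
    under eq_bigr => i _ do rewrite -mulr_suml -mulr_sumr.
    by rewrite -!mulr_suml.
  by rewrite lerDl mulr_ge0 // divr_ge0 ?mulr_ge0 // ltW.
rewrite /Phi -!mulr_sumr.
have PA : \sum_(i < n) p i * p i <= k by apply: le_trans (hsq a ha) A2.
have QB : \sum_(i < n) q i * q i <= k by apply: le_trans (hsq b hb) B2.
have : 9 / 16 * (k * k) <= Ap * Bq.
  by apply: le_trans (_ : (3 / 4 * k) * (3 / 4 * k) <= _); [lra|rewrite ler_pM //; lra].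
set X := \sum_(i < n) \sum_(j < n) _ in hmain *.
have : k / 16 * (\sum_(i < n) p i * p i) <= k / 16 * k by rewrite ler_wpM2l //; lra.
have : k / 16 * (\sum_(i < n) q i * q i) <= k / 16 * k by rewrite ler_wpM2l //; lra.
have : 0 < k * k by rewrite mulr_gt0.
lra.
Qed.

End Potential.

(** * From weights to bicliques *)

Section Spread.
Context (R : realType) (n : nat).
Implicit Types (w p q : 'I_n -> R).

Lemma le_sum_sqr w : (\sum_i w i) ^+ 2 <= n%:R * \sum_i w i * w i.
Proof.
have [n0|nn0] := posnP n.
  by rewrite !big1 ?mulr0 ?expr0n // => i _; exfalso; have := ltn_ord i; lia.
have nR : 0 < n%:R :> R by rewrite ltr0n.
pose c := (\sum_i w i) / n%:R.
have : 0 <= \sum_i (w i - c) ^+ 2 by apply: sumr_ge0 => i _; exact: sqr_ge0.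
rewrite (eq_bigr (fun i => w i * w i - 2 * c * w i + c ^+ 2)); last first.
  by move=> i _; ring.
rewrite big_split /= sumrB -mulr_sumr sumr_const card_ord -(mulr_natr (c ^+ 2)) => h.
rewrite -subr_ge0 (_ : _ - _ = n%:R * (\sum_i w i * w i -
  2 * c * \sum_i w i + c ^+ 2 * n%:R)); last first.
  by rewrite /c; field; rewrite gt_eqF.
by rewrite mulr_ge0 // ltW.
Qed.

(** With [A] and [B] the total weights, the penalty bounds [p i ^ 2] by [A B / L], but the two sides
    are not normalized against each other. Cauchy-Schwarz gives
    [B ^ 2 <= n * \sum q ^ 2 <= n A B / L], so [B <= n A / L] and [p i ^ 2 <= n A ^ 2 / L ^ 2]. *)
Lemma small_atom p q (L : R) (s : nat) :
  (forall i, 0 <= p i) -> (forall i, 0 <= q i) -> 0 < L ->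
  L * (\sum_i p i * p i + \sum_i q i * q i) < (\sum_i p i) * (\sum_i q i) ->
  (2 * s%:R) ^+ 2 * n%:R <= L ^+ 2 ->
  forall i, 2 * s%:R * p i <= \sum_i p i.
Proof.
set A := \sum_i p i; set B := \sum_i q i => p0 q0 L0 hL hs i.
have pp0 : 0 <= \sum_i p i * p i by apply: sumr_ge0 => j _; exact: mulr_ge0.
have qq0 : 0 <= \sum_i q i * q i by apply: sumr_ge0 => j _; exact: mulr_ge0.
have A0 : 0 <= A by exact: sumr_ge0.
have B0 : 0 <= B by exact: sumr_ge0.
have AB0 : 0 < A * B by apply: le_lt_trans hL; rewrite mulr_ge0 ?addr_ge0 // ltW.
have Bp : 0 < B by rewrite lt_def B0 andbT; apply: contraTneq AB0 => ->; rewrite mulr0 ltxx.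
have h1 : p i * p i <= \sum_i p i * p i.
  by rewrite (bigD1 i) //= lerDl sumr_ge0 // => j _; exact: mulr_ge0.
have h2 : L * (p i * p i) <= A * B.
  apply: le_trans (ltW hL); rewrite ler_wpM2l ?(ltW L0) //.
  by rewrite (le_trans h1) // lerDl.
have h3 : L * B <= n%:R * A.
  rewrite -(ler_pM2r Bp) -mulrA -expr2.
  apply: le_trans (_ : L * (n%:R * \sum_i q i * q i) <= _).
    by rewrite ler_wpM2l ?(ltW L0) // le_sum_sqr.
  rewrite mulrCA -[leRHS]mulrA ler_wpM2l //.
  by apply: le_trans (ltW hL); rewrite ler_wpM2l ?(ltW L0) // lerDr.
have h4 : (2 * s%:R * p i) ^+ 2 <= A ^+ 2.
  have nR : 0 < n%:R :> R by rewrite ltr0n (leq_ltn_trans _ (ltn_ord i)).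
  rewrite -(ler_pM2r nR).
  apply: le_trans (_ : L ^+ 2 * (p i * p i) <= _).
    rewrite (_ : _ * n%:R = (2 * s%:R) ^+ 2 * n%:R * (p i * p i)); last by ring.
    by rewrite ler_wpM2r // mulr_ge0.
  apply: le_trans (_ : L * (A * B) <= _).
    by rewrite expr2 -mulrA ler_wpM2l // ltW.
  rewrite mulrCA (_ : A ^+ 2 * n%:R = A * (n%:R * A)); last by ring.
  by rewrite ler_wpM2l.
by rewrite -(@ler_sqr _ (2 * s%:R * p i) A) // nnegrE ?mulr_ge0.
Qed.

Variables (E : {set 'I_n * 'I_n}) (p q : 'I_n -> R) (K L : R) (s : nat).
Hypotheses (p0 : forall i, 0 <= p i) (q0 : forall i, 0 <= q i).
Hypotheses (K0 : 0 < K) (L0 : 0 < L).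

Let loss i := \sum_j (1 - ((i, j) \in E))%:R * q j.

(** By Markov's inequality at least half of the [p]-weight lies in [G]; as no atom exceeds
    [1 / (2 s)] of the total, [G] has at least [s] elements. At most [s] vertices of [G] exclude at
    most [2 s / K <= 1 / 2] of the [q]-weight, and the other half again needs [s] atoms. *)
Lemma biclique_bound (G := [set i | K * loss i <= 2 * \sum_j q j]) :
  K * (\sum_i p i * loss i) + L * (\sum_i p i * p i + \sum_i q i * q i) <
    (\sum_i p i) * (\sum_i q i) ->
  4 * s%:R <= K -> (2 * s%:R) ^+ 2 * n%:R <= L ^+ 2 ->
  (s <= #|G|)%N /\
  (forall S : {set 'I_n}, S \subset G -> (#|S| <= s)%N -> (s <= #|common E S|)%N).
Proof.
set A := \sum_i p i; set B := \sum_i q i => hAB hK hL.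
have loss0 i : 0 <= loss i by apply: sumr_ge0 => j _; rewrite mulr_ge0.
have N0 : 0 <= K * (\sum_i p i * loss i).
  by rewrite mulr_ge0 ?(ltW K0) //; apply: sumr_ge0 => i _; rewrite mulr_ge0.
have pp0 : 0 <= \sum_i p i * p i by apply: sumr_ge0 => j _; exact: mulr_ge0.
have qq0 : 0 <= \sum_i q i * q i by apply: sumr_ge0 => j _; exact: mulr_ge0.
have LP0 : 0 <= L * (\sum_i p i * p i + \sum_i q i * q i).
  by rewrite mulr_ge0 ?addr_ge0 // ltW.
have A0 : 0 <= A by exact: sumr_ge0.
have B0 : 0 <= B by exact: sumr_ge0.
have AB0 : 0 < A * B by apply: le_lt_trans hAB; rewrite addr_ge0.
have Ap : 0 < A by rewrite lt_def A0 andbT; apply: contraTneq AB0 => ->; rewrite mul0r ltxx.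
have Bp : 0 < B by rewrite lt_def B0 andbT; apply: contraTneq AB0 => ->; rewrite mulr0 ltxx.
have hLp : L * (\sum_i p i * p i + \sum_i q i * q i) < A * B.
  by apply: le_lt_trans hAB; rewrite lerDr.
have hp := small_atom p0 q0 L0 hLp hL.
have hq : forall j, 2 * s%:R * q j <= B.
  by apply: (@small_atom q p L) => //; rewrite addrC [ltRHS]mulrC.
have hmass (w : 'I_n -> R) (C : R) (X : {set 'I_n}) : 0 < C ->
    (forall i, 2 * s%:R * w i <= C) -> C / 2 <= \sum_(i in X) w i -> (s <= #|X|)%N.
  move=> C0 hw hX; rewrite -(ler_nat R) -(ler_pM2r C0).
  apply: le_trans (_ : \sum_(i in X) 2 * s%:R * w i <= _).
    rewrite -mulr_sumr; apply: le_trans (_ : 2 * s%:R * (C / 2) <= _).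
      by rewrite le_eqVlt; apply/orP; left; apply/eqP; field.
    by rewrite ler_wpM2l.
  apply: le_trans (ler_sum _ (fun i _ => hw i)) _.
  by rewrite sumr_const mulr_natl.
split.
  apply: (hmass p A) => //.
  have : K * (\sum_i p i * loss i) <= A * B.
    by apply: le_trans (ltW hAB); rewrite lerDl.
  have : \sum_(i | i \notin G) p i * (2 * B) <= K * (\sum_i p i * loss i).
    rewrite mulr_sumr [leRHS](bigID (fun i => i \in G)) /= -[leLHS]add0r lerD //.
      by apply: sumr_ge0 => i _; rewrite !mulr_ge0 // ltW.
    apply: ler_sum => i; rewrite inE -ltNge => /ltW h.
    by rewrite [leRHS]mulrCA ler_wpM2l.
  rewrite -mulr_suml => h1 h2.
  have h3 : \sum_(i | i \notin G) p i <= A / 2.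
    rewrite -(ler_pM2r (_ : 0 < 2 * B)) ?mulr_gt0 //.
    rewrite (_ : A / 2 * (2 * B) = A * B); last by field.
    exact: le_trans h1 h2.
  have : A = \sum_(i in G) p i + \sum_(i | i \notin G) p i by rewrite /A (bigID (fun i => i \in G)).
  lra.
move=> S hSG hS; apply: (hmass q B) => //.
have hout : \sum_(j | j \notin common E S) q j <= \sum_(i in S) loss i.
  rewrite exchange_big /= [leRHS](bigID (fun j => j \in common E S)) /=.
  rewrite -[leLHS]add0r lerD //.
    by apply: sumr_ge0 => j _; apply: sumr_ge0 => i _; rewrite mulr_ge0.
  apply: ler_sum => j; rewrite inE negb_forall => /existsP[i].
  rewrite negb_imply => /andP[iS hE].
  rewrite (bigD1 i) //= (negPf hE) mul1r lerDl.
  by apply: sumr_ge0 => i' _; rewrite mulr_ge0.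
have hS2 : K * \sum_(i in S) loss i <= s%:R * (2 * B).
  rewrite mulr_sumr; apply: le_trans (_ : \sum_(i in S) 2 * B <= _).
    by apply: ler_sum => i /(fintype.subsetP hSG); rewrite inE.
  by rewrite sumr_const -(mulr_natl (2 * B)) ler_wpM2r ?mulr_ge0 // ler_nat.
have h1 : \sum_(i in S) loss i <= B / 2.
  rewrite -(ler_pM2l K0); apply: le_trans hS2 _.
  apply: le_trans (_ : 4 * s%:R * (B / 2) <= _).
    by rewrite le_eqVlt; apply/orP; left; apply/eqP; field.
  by rewrite ler_wpM2r // divr_ge0.
have : B = \sum_(j in common E S) q j + \sum_(j | j \notin common E S) q j.
  by rewrite /B (bigID (fun i => i \in common E S)).
lra.
Qed.

End Spread.

(** * Choice of the parameters *)

Section Numeric.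
Context (R : realType).

Lemma expR_le_inv (x : R) : x < 1 -> expR x <= (1 - x)^-1.
Proof.
move=> x1; have h := expR_ge1Dx (- x).
rewrite -[expR x]invrK -expRN lef_pV2 ?posrE ?expR_gt0 //.
by rewrite subr_gt0.
Qed.

(** This amounts to [e < 3]. The value is positive but small, and [D] has to compensate for it. *)
Lemma ln_ln3_gt0 : 0 < ln (ln 3) :> R.
Proof.
suff h : 1 < ln 3 :> R by rewrite ln_gt0.
suff h : expR 1 < 3 :> R by rewrite -[ltLHS](@expRK R 1) ltr_ln ?posrE ?expR_gt0.
(* The sixth power of [6 / 5] is 2.985984. *)
have e6 : expR (6^-1) <= 6 / 5 :> R.
  by apply: le_trans (expR_le_inv _) _; [lra|rewrite le_eqVlt; apply/orP; left; apply/eqP; field].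
have -> : expR 1 = expR (6%:R * 6^-1) :> R by congr expR; field.
rewrite expRM_natl; apply: le_lt_trans (_ : (6 / 5) ^+ 6 < _); last by lra.
by rewrite lerXn2r // nnegrE ?expR_ge0 // divr_ge0.
Qed.

Lemma harmonic_bounds n : (0 < n)%N ->
  ln n%:R <= \sum_(i < n) (i.+1%:R : R)^-1 <= 1 + ln n%:R.
Proof.
case: n => // n _; apply/andP; split.
  (* Strengthened to the logarithm of one more than the number of terms, so that [ln (1 + x) <= x]
     telescopes. *)
  apply: (@le_trans _ _ (ln n.+2%:R)); first by rewrite ler_ln ?posrE ?ltr0n // ler_nat.
  elim: n.+1 => [|m IH]; first by rewrite big_ord0 ln1.
  rewrite big_ord_recr /=; apply: le_trans (lerD IH (lexx _)).
  have m0 : 0 < m.+1%:R :> R by rewrite ltr0n.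
  rewrite (_ : m.+2%:R = m.+1%:R * (1 + m.+1%:R^-1)); last first.
    by rewrite mulrDr mulr1 divff ?gt_eqF // natr1.
  have i0 : 0 < m.+1%:R^-1 :> R by rewrite invr_gt0.
  have h : ln (1 + m.+1%:R^-1) <= m.+1%:R^-1 :> R.
    by apply: le_ln1Dx; apply: lt_trans i0; rewrite ltrN10.
  by rewrite lnM ?posrE ?lerD2l // addr_gt0.
elim: n => [|m IH]; first by rewrite big_ord1 ln1 invr1 addr0.
rewrite big_ord_recr /=; apply: le_trans (lerD IH (lexx _)) _.
rewrite -addrA lerD2l.
have m0 : 0 < m.+1%:R :> R by rewrite ltr0n.
have m1 : 0 < m.+2%:R :> R by rewrite ltr0n.
have i0 : 0 < m.+2%:R^-1 :> R by rewrite invr_gt0.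
have i1 : m.+2%:R^-1 < 1 :> R by rewrite invf_lt1 // ltr1n.
rewrite {1}(_ : m.+1%:R = m.+2%:R * (1 + - m.+2%:R^-1)); last first.
  by rewrite mulrDr mulr1 mulrN divff ?gt_eqF // -[m.+2%:R]natr1 addrK.
have : ln (1 + - m.+2%:R^-1) <= - m.+2%:R^-1 :> R.
  by apply: le_ln1Dx; rewrite ltrN2.
rewrite lnM ?posrE ?subr_gt0 // => h.
by rewrite -addrA gerDl; have := lerD h (lexx (m.+2%:R^-1)); rewrite addNr.
Qed.

Lemma expR_half_le1D (x : R) : 0 <= x <= 1 -> expR (x / 2) <= 1 + x.
Proof.
move=> /andP[x0 x1]; apply: le_trans (expR_le_inv _) _; first by lra.
have h : 0 < 1 - x / 2 by lra.
rewrite -[leLHS]mul1r ler_pdivrMr //; nra.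
Qed.

Lemma expRN_le1B_half (x : R) : 0 <= x <= 1 -> expR (- x) <= 1 - x / 2.
Proof.
move=> /andP[x0 x1]; have h := expR_ge1Dx x.
rewrite expRN; have h1 : 0 < 1 + x by lra.
apply: (@le_trans _ _ (1 + x)^-1).
  by rewrite lef_pV2 ?posrE ?expR_gt0.
rewrite -[leLHS]mul1r ler_pdivrMr //; nra.
Qed.

(** To first order [beta] takes away half of the gain [eps] of [K] per step, leaving
    [1 + eps / 2 >= exp (eps / 4)]; for [L] it costs at most a factor [exp (- eps)]. *)
Lemma growth_bounds (eps r : R) T (beta := 1 - eps / 2) : 0 <= eps < 1 -> 0 <= r ->
  expR (eps * T%:R / 4) <= (beta / (1 - eps)) ^+ T /\
  expR (- (eps * T%:R * (1 + r))) <= (beta / (1 + eps * r)) ^+ T.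
Proof.
move=> /andP[e0 e1] r0; have e1' : 0 < 1 - eps by lra.
have er : 0 <= eps * r by exact: mulr_ge0.
split.
  rewrite (_ : eps * T%:R / 4 = T%:R * (eps / 2 / 2)); last by field.
  rewrite expRM_natl lerXn2r ?nnegrE ?expR_ge0 ?divr_ge0 // /beta; try lra.
  apply: le_trans (expR_half_le1D _) _; first by lra.
  rewrite ler_pdivlMr //; nra.
rewrite (_ : - _ = T%:R * (- eps + - (eps * r))); last by ring.
have hb : 0 <= beta by rewrite /beta; lra.
have h1 : 0 < 1 + eps * r by lra.
rewrite expRM_natl lerXn2r ?nnegrE ?expR_ge0 ?divr_ge0 ?(ltW h1) //.
rewrite expRD ler_pM ?expR_ge0 //; first by rewrite expRN_le1B_half // e0 ltW.
by rewrite expRN lef_pV2 ?posrE ?expR_gt0 // expR_ge1Dx.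
Qed.

(** Everything depends on [eps * (n * d) = j ^ 2 / n], about [H k / (128 n)]. [K] must exceed the
    square of the target, up to a constant, and [L] must stay above [sqrt n] times the target. *)
Lemma parameters (n d j : nat) (D k H : R) (s := j%:R / n%:R : R)
    (eps := s * s / d%:R) (beta := 1 - eps / 2) (r := 4 * n%:R / k) :
  (3 <= n)%N -> (0 < d)%N -> 64 * 64 <= D -> 16 <= D * ln (ln 3) ->
  n%:R * (D * ln (ln n%:R) / ln n%:R) <= k -> k <= n%:R ->
  ln n%:R <= H <= 1 + ln n%:R -> (j <= n)%N ->
  ((0 < j)%N -> 128 * (j%:R * j%:R) <= H * k) ->
  ((j < n)%N -> H * k < 128 * (j.+1%:R * j.+1%:R)) ->
  [/\ 0 < k, 0 <= eps < 1, s * s * r <= 1 & exists S : nat,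
    [/\ n%:R `^ (1 / (D * (n%:R / k))) <= S%:R,
        4 * S%:R <= 1 / 2 * (beta / (1 - eps)) ^+ (n * d) &
        (2 * S%:R) ^+ 2 * n%:R <= (k / 16 * (beta / (1 + eps * r)) ^+ (n * d)) ^+ 2]].
Proof.
move=> n3 d0 D0 Dl kl kn /andP[H1 H2] jn j1 j2.
set l := ln n%:R in kl H1 H2.
have n0 : 0 < n%:R :> R by rewrite ltr0n (leq_trans _ n3).
have d0' : 1 <= d%:R :> R by rewrite ler1n.
have Dp : 0 < D by lra.
have hD z : 0 <= z -> 64 * 64 * z <= D * z by move=> z0; rewrite ler_wpM2r.
clear D0.
have l3 : 1 < ln 3 :> R.
  have := ln_ln3_gt0; rewrite ltNge => /negP h; rewrite ltNge; apply/negP => h'.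
  by apply: h; apply: ln_le0.
have ll : ln 3 <= l by rewrite ler_ln ?posrE ?ler_nat //.
have l0 : 0 < l by lra.
have hll : ln (ln 3) <= ln l :> R by rewrite ler_ln ?posrE //; lra.
have hlnl : 16 <= D * ln l by apply: le_trans Dl _; rewrite ler_pM2l.
have hkl : n%:R * (D * ln l) <= k * l.
  by move: kl; rewrite mulrA ler_pdivrMr.
have k0 : 0 < k.
  rewrite -(pmulr_lgt0 _ l0); apply: lt_le_trans hkl; rewrite mulr_gt0 //; lra.
(* As [k <= n], the lower bound on [k] gives [D * ln l <= l]: small [n] cannot occur. *)
have hl16 : 16 <= l.
  have : D * ln l <= l.
    rewrite -(ler_pM2l n0); apply: le_trans hkl _.
    by rewrite ler_wpM2r // ltW.
  by apply: le_trans.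
have hln : l <= n%:R - 1.
  have := @le_ln1Dx R (n%:R - 1); rewrite (addrC 1) subrK; apply.
  by rewrite ltrBrDl subrr.
have H0 : 0 <= H by exact: le_trans (ltW l0) H1.
have Hn : H <= n%:R by clear - H2 hln; lra.
have hHk : 16 * n%:R <= H * k.
  apply: (@le_trans _ _ (l * k)); last by rewrite ler_wpM2r // ltW.
  rewrite mulrC [leRHS]mulrC; apply: le_trans hkl; by rewrite ler_wpM2l // ltW.
(* [j = 0] would mean [H * k < 128], but [H * k >= 16 n] and [n >= l + 1 >= 17]. *)
have jpos : (0 < j)%N.
  rewrite lt0n; apply/eqP => j0; move: j2; rewrite j0 => /(_ (ltnW (ltnW n3))); lra.
have jR : 1 <= j%:R :> R by rewrite ler1n.
have hj := j1 jpos.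
(* The root search was not cut short by its [n] turns, so the upper bound on [H * k] is
   available. *)
have jn' : (j < n)%N.
  rewrite ltn_neqAle jn andbT; apply/eqP => je; move: hj; rewrite je.
  have : H * k <= n%:R * n%:R by rewrite ler_pM // ltW.
  have : 0 < n%:R * n%:R :> R by rewrite mulr_gt0.
  clear - n; lra.
have jnR : j%:R < n%:R :> R by rewrite ltr_nat.
have hj2 : H * k <= 4 * 128 * (j%:R * j%:R).
  apply: le_trans (ltW (j2 jn')) _; rewrite -natr1.
  clear - jR; nra.
have s0 : 0 <= s < 1.
  by rewrite /s divr_ge0 //= ltr_pdivrMr // mul1r.
have ss1 : 0 <= s * s < 1.
  by case/andP: s0 => s0 s1; rewrite mulr_ge0 //= mulr_ilt1.
have d1 : 0 < d%:R :> R by exact: lt_le_trans ltr01 d0'.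
have he : 0 <= eps < 1.
  case/andP: ss1 => ss0 ss1; rewrite /eps divr_ge0 //= ltr_pdivrMr // mul1r.
  exact: lt_le_trans ss1 d0'.
have r1 : 1 <= r.
  by rewrite /r ler_pdivlMr // mul1r; clear - kn n0; lra.
have hT : eps * (n * d)%:R = j%:R * j%:R / n%:R.
  by rewrite natrM /eps /s; field; rewrite !gt_eqF.
split=> //.
  rewrite (_ : s * s * r = 4 * (j%:R * j%:R) / (n%:R * k)); last first.
    by rewrite /s /r; field; rewrite !gt_eqF.
  rewrite ler_pdivrMr ?mulr_gt0 // mul1r.
  have : H * k <= n%:R * k by rewrite ler_wpM2r // ltW.
  have : 0 <= n%:R * k by rewrite mulr_ge0 // ltW.
  clear - hj; lra.
have [g1 g2] := growth_bounds (n * d) he (ltW (lt_le_trans ltr01 r1)).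
rewrite -/beta hT in g1 g2.
set tau := n%:R `^ _.
have tauE : tau = expR (l * k / (n%:R * D)).
  rewrite /tau /powR (gt_eqF n0) -/l; congr expR; field; by rewrite !gt_eqF.
(* The exponent of [tau] is [l * k / (n * D)], and the lower bound on [k] says that it is at least
   [ln l]. *)
have htl : l <= tau.
  rewrite tauE -{1}(@lnK R l) ?posrE // ler_expR ler_pdivlMr ?mulr_gt0 //.
  by rewrite mulrC -mulrA (mulrC l).
have ht16 : 16 <= tau by exact: le_trans hl16 htl.
have htn : tau ^+ 8 <= expR l.
  rewrite tauE -expRM_natl ler_expR.
  rewrite mulrA ler_pdivrMr ?mulr_gt0 // [leRHS]mulrC [leRHS]mulrC.
  have : k * l <= n%:R * l by rewrite ler_wpM2r // ltW.
  have : 64 * 64 * (n%:R * l) <= D * (n%:R * l) by rewrite hD // mulr_ge0 // ltW.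
  have : 0 < n%:R * l by rewrite mulr_gt0.
  clear - n; lra.
(* The target has to be an integer; rounding up costs at most 1, negligible since [tau >= 16]. *)
exists (Num.truncn tau).+1.
have /andP[t1 t2] := truncn_itv (le_trans (ler0n _ 16) ht16).
set S := (Num.truncn tau).+1.
have S1 : S%:R <= tau + 1 by rewrite /S -natr1 lerD2r.
have S0 : 0 <= S%:R :> R by [].
split; first exact: ltW.
  apply: (@le_trans _ _ (1 / 2 * tau ^+ 2)); first by rewrite expr2; clear - S1 ht16; nra.
  rewrite ler_wpM2l //; apply: le_trans g1.
  (* Needed: [8 l k <= D j ^ 2]. As [l k <= 512 j ^ 2], the constant [64 * 64 = 8 * 512]
     suffices. *)
  rewrite tauE -expRM_natl ler_expR mulrA ler_pdivrMr ?mulr_gt0 //.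
  rewrite (_ : j%:R * j%:R / n%:R / 4 * (n%:R * D) = j%:R * j%:R * D / 4); last first.
    by field; rewrite gt_eqF.
  have h1 : l * k <= 4 * 128 * (j%:R * j%:R).
    by apply: le_trans hj2; rewrite ler_wpM2r // ltW.
  have : 64 * 64 * (j%:R * j%:R) <= D * (j%:R * j%:R) by rewrite hD // mulr_ge0.
  clear - h1; lra.
have hk : expR l / tau <= k / 16.
  rewrite lnK ?posrE // ler_pdivrMr; last by rewrite (lt_le_trans _ ht16).
  have : 16 * n%:R <= k * l.
    by apply: le_trans hkl; rewrite mulrC ler_wpM2l // ltW.
  have : k * l <= k * tau by rewrite ler_wpM2l // ltW.
  clear - n; lra.
(* The exponent is at most [8 j ^ 2 / k <= H / 16 <= l / 8]: [L] loses at most a factor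
   [n ^ (1 / 8)]. *)
have hL : expR (- (l / 8)) <= (beta / (1 + eps * r)) ^+ (n * d).
  apply: le_trans g2; rewrite ler_expR lerN2.
  apply: le_trans (_ : j%:R * j%:R / n%:R * (2 * r) <= _).
    by rewrite ler_wpM2l ?divr_ge0 ?mulr_ge0 //; clear - r1; lra.
  rewrite (_ : j%:R * j%:R / n%:R * (2 * r) = 8 * (j%:R * j%:R) / k); last first.
    by rewrite /r; field; rewrite !gt_eqF.
  rewrite ler_pdivrMr //.
  have : H * k <= 2 * l * k.
    by rewrite ler_wpM2r ?(ltW k0) //; clear - H2 hl16; lra.
  clear - hj; lra.
have tau0 : 0 < tau by rewrite (lt_le_trans _ ht16).
have hL2 : expR l / tau * expR (- (l / 8)) <= k / 16 * (beta / (1 + eps * r)) ^+ (n * d).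
  by rewrite ler_pM ?expR_ge0 // divr_ge0 ?expR_ge0 // ltW.
have h0 : 0 <= expR l / tau * expR (- (l / 8)).
  by rewrite mulr_ge0 ?expR_ge0 // divr_ge0 ?expR_ge0 // ltW.
apply: le_trans (_ : (expR l / tau * expR (- (l / 8))) ^+ 2 <= _); last first.
  by rewrite lerXn2r // nnegrE // (le_trans h0).
have -> : (n%:R : R) = expR l by rewrite lnK ?posrE.
(* With [u = n ^ (1 / 8)], [L] is at least [u ^ 7 / tau]. After division by [n = u ^ 8] it remains
   to see [16 * tau ^ 4 <= u ^ 6], from [16 <= tau ^ 2] and [tau <= u]. *)
set u := expR (l / 8).
have u0 : 0 < u by exact: expR_gt0.
have eu : expR l = u ^+ 8 by rewrite /u -expRM_natl; congr expR; field.
rewrite expRN -/u eu.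
have tu : tau <= u.
  by rewrite -(@ler_pXn2r _ 8) ?nnegrE ?(ltW u0) ?(ltW tau0) // -eu.
apply: le_trans (_ : (4 * tau) ^+ 2 * u ^+ 8 <= _).
  rewrite ler_wpM2r ?exprn_ge0 ?(ltW u0) // lerXn2r ?nnegrE ?mulr_ge0 ?(ltW tau0) //.
  clear - S1 ht16; lra.
rewrite (_ : (u ^+ 8 / tau / u) ^+ 2 = u ^+ 6 / tau ^+ 2 * u ^+ 8); last first.
  by field; rewrite !gt_eqF.
rewrite ler_wpM2r ?exprn_ge0 ?(ltW u0) // ler_pdivlMr ?exprn_gt0 //.
apply: le_trans (_ : tau ^+ 6 <= _); last first.
  by rewrite lerXn2r // nnegrE ltW.
rewrite (_ : (4 * tau) ^+ 2 * tau ^+ 2 = 16 * tau ^+ 4); last by ring.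
rewrite (_ : tau ^+ 6 = tau ^+ 2 * tau ^+ 4); last by ring.
rewrite ler_wpM2r ?exprn_ge0 ?(ltW tau0) // expr2; clear - ht16; nra.
Qed.

End Numeric.

(** * Correctness *)

Section Descent.
Context (R : realType).
Implicit Types (m : memory R).

Lemma eq_Phi n (W W' : nat -> nat -> R) (L : R) (p q p' q' : nat -> R) :
  (forall i j, (i < n)%N -> (j < n)%N -> W i j = W' i j) ->
  (forall i, (i < n)%N -> p i = p' i) -> (forall i, (i < n)%N -> q i = q' i) ->
  Phi n W L p q = Phi n W' L p' q'.
Proof.
move=> eW ep eq; rewrite /Phi; congr (_ + _ + _); apply: eq_bigr => i _.
- by apply: eq_bigr => j _; rewrite eW // ep // eq.
- by rewrite ep.
- by rewrite eq.
Qed.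

Lemma one_add_gt0 (eps z : R) : 0 <= eps < 1 -> -1 <= z -> 0 < 1 + eps * z.
Proof. by move=> /andP[e0 e1] z1; nra. Qed.

(** A coordinate is at most [sqrt r] in absolute value, so [s * s * r <= 1] keeps every factor
    nonnegative whichever move is chosen. *)
Lemma move_ge0 (s x r w : R) : 0 <= w -> (w != 0 -> x * x <= r) ->
  s * s * r <= 1 -> 0 <= w * (1 + s * x).
Proof.
move=> w0 hx hs; have [->|wn] := eqVneq w 0; first by rewrite mul0r.
have h : (s * x) ^+ 2 <= 1.
  apply: le_trans hs; rewrite (_ : _ ^+ 2 = s * s * (x * x)); last by ring.
  by rewrite ler_wpM2l ?hx // -expr2 sqr_ge0.
rewrite mulr_ge0 // -lerBlDl sub0r.
have : `|s * x| <= 1 by rewrite -(@expr_le1 _ 2) // real_normK ?num_real.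
by rewrite ler_norml => /andP[].
Qed.

(** The bounds on norms and on [M] are known only where the initial weights are nonzero. They remain
    usable because multiplicative updates never enlarge the supports, which is part of the
    invariant. *)
Lemma descent_spec m (m' := sem descent m) (n := nmem m 0 0 0) (d := nmem m 1 0 0)
   (s := rmem m 8 0 0) (eps := rmem m 9 0 0) (beta := rmem m 10 0 0)
   (r := rmem m 7 0 0) (M := rmem m 13) (x := rmem m 11) (y := rmem m 12) :
  (0 < d)%N -> eps = s * s / d%:R -> beta = 1 - eps / 2 -> 0 <= eps < 1 ->
  0 <= r -> s * s * r <= 1 -> 0 <= rmem m 18 0 0 ->
  (forall i j, (i < n)%N -> (j < n)%N -> M i j = \sum_(c < d) x i c * y j c) ->
  (forall i, (i < n)%N -> 0 <= rmem m 15 0 i) ->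
  (forall i, (i < n)%N -> 0 <= rmem m 16 0 i) ->
  (forall i, (i < n)%N -> rmem m 15 0 i != 0 -> \sum_(c < d) x i c * x i c <= r) ->
  (forall j, (j < n)%N -> rmem m 16 0 j != 0 -> \sum_(c < d) y j c * y j c <= r) ->
  (forall i j, (i < n)%N -> (j < n)%N -> rmem m 15 0 i != 0 -> rmem m 16 0 j != 0 ->
     -1 <= M i j) ->
  0 < Phi n (rmem m 14) (rmem m 18 0 0) (rmem m 15 0) (rmem m 16 0) ->
  [/\ rmem m' 17 0 0 = rmem m 17 0 0 * (beta / (1 - eps)) ^+ (n * d),
      rmem m' 18 0 0 = rmem m 18 0 0 * (beta / (1 + eps * r)) ^+ (n * d),
      forall i j, (i < n)%N -> (j < n)%N ->
        rmem m' 14 i j = rmem m 14 i j / growth_at m i j ^+ (n * d),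
      (forall i, (i < n)%N -> 0 <= rmem m' 15 0 i /\ 0 <= rmem m' 16 0 i /\
        (rmem m' 15 0 i != 0 -> rmem m 15 0 i != 0) /\
        (rmem m' 16 0 i != 0 -> rmem m 16 0 i != 0)) &
      0 < Phi n (rmem m' 14) (rmem m' 18 0 0) (rmem m' 15 0) (rmem m' 16 0)].
Proof.
move=> d0 epsE betaE he r0 hs L0 hM p0 q0 hp hq hpq hPhi.
have [e0 e1] := andP he.
have b0 : 0 < beta by rewrite betaE; lra.
have er0 : 0 < 1 + eps * r by rewrite ltr_wpDr // mulr_ge0.
pose I N m' := [/\ rmem m' 17 0 0 = rmem m 17 0 0 * (beta / (1 - eps)) ^+ N,
      rmem m' 18 0 0 = rmem m 18 0 0 * (beta / (1 + eps * r)) ^+ N,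
      forall i j, (i < n)%N -> (j < n)%N ->
        rmem m' 14 i j = rmem m 14 i j / growth_at m i j ^+ N,
      (forall i, (i < n)%N -> 0 <= rmem m' 15 0 i /\ 0 <= rmem m' 16 0 i /\
        (rmem m' 15 0 i != 0 -> rmem m 15 0 i != 0) /\
        (rmem m' 16 0 i != 0 -> rmem m 16 0 i != 0)) &
      0 < Phi n (rmem m' 14) (rmem m' 18 0 0) (rmem m' 15 0) (rmem m' 16 0)].
apply: (@iter2_inv R I 8 Ln 9 Ld (decay ;; search ;; move) m) => //.
  split; rewrite ?expr0 ?mulr1 //.
    by move=> i j _ _; rewrite expr0 divr1.
  by move=> i hi; rewrite p0 ?q0.
move=> N m1 hN hm [I1 I2 I3 I4 I5].
set m2 := sem decay m1; set m3 := sem search m2; set m4 := sem move m3.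
rewrite -[sem _ m1]/m4.
have f2 : agree (nwrites decay) (rwrites decay) m1 m2 := frame decay m1.
have f3 : agree (nwrites search) (rwrites search) m2 m3 := frame search m2.
have f4 : agree (nwrites move) (rwrites move) m3 m4 := frame move m3.
have [D1 D2 D3] := decay_spec m1; rewrite -/m2 in D1 D2 D3.
have en1 : nmem m1 0 0 0 = n by rewrite (proj1 hm).
have ed1 : nmem m1 1 0 0 = d by rewrite (proj1 hm).
have en2 : nmem m2 0 0 0 = n by rewrite (proj1 f2).
have ed2 : nmem m2 1 0 0 = d by rewrite (proj1 f2).
have en3 : nmem m3 0 0 0 = n by rewrite (proj1 f3).
have e9 : rmem m1 9 0 0 = eps by rewrite (proj2 hm).
have e10 : rmem m1 10 0 0 = beta by rewrite (proj2 hm).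
have e7 : rmem m1 7 0 0 = r by rewrite (proj2 hm).
have e8 : rmem m2 8 0 0 = s by rewrite (proj2 f2) // (proj2 hm).
have ex1 i c : rmem m1 11 i c = x i c by rewrite (proj2 hm).
have ey1 i c : rmem m1 12 i c = y i c by rewrite (proj2 hm).
have ex2 i c : rmem m2 11 i c = x i c by rewrite (proj2 f2).
have ey2 i c : rmem m2 12 i c = y i c by rewrite (proj2 f2).
have ep2 i : rmem m2 15 0 i = rmem m1 15 0 i by rewrite (proj2 f2).
have eq2 i : rmem m2 16 0 i = rmem m1 16 0 i by rewrite (proj2 f2).
have ep3 i : rmem m3 15 0 i = rmem m1 15 0 i by rewrite (proj2 f3).
have eq3 i : rmem m3 16 0 i = rmem m1 16 0 i by rewrite (proj2 f3).
have efac i j : growth_at m1 i j = (1 + eps * M i j) / beta.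
  by rewrite /growth_at e9 e10 (proj2 hm).
have efac0 i j : growth_at m i j = (1 + eps * M i j) / beta by [].
rewrite e9 e10 in D1 D2; rewrite e7 in D2.
have ppos i : (i < n)%N -> 0 <= rmem m1 15 0 i by case/I4.
have qpos i : (i < n)%N -> 0 <= rmem m1 16 0 i by case/I4=> _ [].
have psup i : (i < n)%N -> rmem m1 15 0 i != 0 -> rmem m 15 0 i != 0.
  by case/I4=> _ [_ []].
have qsup i : (i < n)%N -> rmem m1 16 0 i != 0 -> rmem m 16 0 i != 0.
  by case/I4=> _ [_ []].
have hL1 : 0 <= rmem m1 18 0 0.
  rewrite I2 mulr_ge0 // exprn_ge0 // divr_ge0 ?ltW //.
have [c0 [hc0 hF]] := @potential_step R n d (rmem m1 14) M x y (rmem m1 18 0 0) s eps r beta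
  (rmem m1 15 0) (rmem m1 16 0) d0 epsE e0 b0 hL1 r0 hM
  (fun i hi h => hp i hi (psup i hi h)) (fun j hj h => hq j hj (qsup j hj h))
  (fun i j hi hj h h' => one_add_gt0 he (hpq i j hi hj (psup i hi h) (qsup j hj h')))
  I5.
have epot t c : pot m2 t c = Phi n
    (fun i j => rmem m1 14 i j / ((1 + eps * M i j) / beta))
    (rmem m1 18 0 0 * (beta / (1 + eps * r)))
    (fun i => rmem m1 15 0 i * (1 + t * x i c))
    (fun j => rmem m1 16 0 j * (1 + t * y j c)).
  rewrite /pot en2 D2; apply: eq_Phi => [i j hi hj|i hi|i hi].
  - by rewrite D3 ?en1 // efac.
  - by rewrite ep2 ex2.
  - by rewrite eq2 ey2.
have hsearch := search_spec (m := m2).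
rewrite e8 ed2 in hsearch.
have [|c [t [hc ht hpot e11 e21]]] := hsearch.
  by exists c0; split=> //; rewrite !epot.
rewrite -/m3 in e11 e21.
have [V1 V2] := move_spec m3; rewrite -/m4 en3 e11 e21 in V1 V2.
have tt : t * t = s * s by case: ht => ->; rewrite ?mulrNN.
have hsq (z : nat -> nat -> R) i : \sum_(c < d) z i c * z i c <= r ->
    z i c * z i c <= r.
  apply: le_trans; rewrite (bigD1 (Ordinal hc)) //= lerDl sumr_ge0 // => c' _.
  by rewrite -expr2 sqr_ge0.
have P1 i : (i < n)%N -> rmem m4 15 0 i = rmem m1 15 0 i * (1 + t * x i c).
  by move=> hi; rewrite V1 // ep3 (proj2 f3) // ex2.
have Q1 i : (i < n)%N -> rmem m4 16 0 i = rmem m1 16 0 i * (1 + t * y i c).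
  by move=> hi; rewrite V2 // eq3 (proj2 f3) // ey2.
have W1 i j : (i < n)%N -> (j < n)%N ->
    rmem m4 14 i j = rmem m1 14 i j / ((1 + eps * M i j) / beta).
  by move=> hi hj; rewrite (proj2 f4) // (proj2 f3) // D3 ?en1 // efac.
have L1 : rmem m4 18 0 0 = rmem m1 18 0 0 * (beta / (1 + eps * r)).
  by rewrite (proj2 f4) // (proj2 f3).
split.
- by rewrite (proj2 f4) // (proj2 f3) // D1 I1 exprSr [RHS]mulrA.
- by rewrite L1 I2 exprSr [RHS]mulrA.
- by move=> i j hi hj; rewrite W1 // I3 // exprSr efac0 (invfM (_ ^+ N)) [RHS]mulrA.
- move=> i hi; rewrite P1 // Q1 //; split; last split; last split.
  + apply: (@move_ge0 t (x i c) r) => //; rewrite ?tt ?ppos // => h.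
    by apply: hsq; apply: hp => //; apply: psup.
  + apply: (@move_ge0 t (y i c) r) => //; rewrite ?tt ?qpos // => h.
    by apply: hsq; apply: hq => //; apply: qsup.
  + by rewrite mulf_eq0 negb_or => /andP[h _]; apply: psup.
  + by rewrite mulf_eq0 negb_or => /andP[h _]; apply: qsup.
- rewrite L1 (@eq_Phi n _ (fun i j => rmem m1 14 i j / ((1 + eps * M i j) / beta))
    _ _ _ (fun i => rmem m1 15 0 i * (1 + t * x i c))
    (fun j => rmem m1 16 0 j * (1 + t * y j c))) //.
  by rewrite -epot.
Qed.

End Descent.

(** * Values computed before the walk *)

Section Setup.
Context (R : realType).
Implicit Types (m : memory R).

Lemma semSq p q m : sem (Sq p q) m = sem q (sem p m).
Proof. by []. Qed.

Lemma setup_scalars m (ms := sem setup m) (n := nmem m 0 0 0) (d := nmem m 1 0 0)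
    (j := nmem ms 10 0 0) (k := rmem ms 5 0 0) (H := rmem ms 6 0 0)
    (s := rmem ms 8 0 0) (eps := rmem ms 9 0 0) :
  [/\ (forall i, (i < n)%N -> rmem ms 3 0 i = \sum_(c < d) rmem m 1 i c * rmem m 0 0 c),
      (forall i, (i < n)%N -> rmem ms 4 0 i = \sum_(c < d) rmem m 2 i c * rmem m 0 0 c),
      k = \sum_(i < n) rmem ms 3 0 i, H = \sum_(i < n) (i.+1%:R)^-1 &
      rmem ms 7 0 0 = 4 * n%:R / k] /\
  [/\ (j <= n)%N, (0 < j)%N -> 128 * (j%:R * j%:R) <= H * k &
      (j < n)%N -> H * k < 128 * (j.+1%:R * j.+1%:R)] /\
  [/\ s = j%:R / n%:R, eps = s * s / d%:R, rmem ms 10 0 0 = 1 - eps / 2 &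
      rmem ms 18 0 0 = k / 16 /\ rmem ms 17 0 0 = 1 / 2].
Proof.
pose s6 := recenter 1 3 11 ;; recenter 2 4 12 ;; gram ;; select 3 15 ;; select 4 16 ;;
  weights.
pose s5 := levels ;; s6. pose s4 := stepsize ;; s5. pose s3 := root_search ;; s4.
pose s2 := scalars ;; s3. pose s1 := prod_with_e 2 4 ;; s2.
(* The intermediate memories become opaque, related only by specifications and frame conditions. *)
have [m1 h1] : {x | x = sem (prod_with_e 1 3) m} by eexists.
have [m2 h2] : {x | x = sem (prod_with_e 2 4) m1} by eexists.
have [m3 h3] : {x | x = sem scalars m2} by eexists.
have [m4 h4] : {x | x = sem root_search m3} by eexists.
have [m5 h5] : {x | x = sem stepsize m4} by eexists.
have [m6 h6] : {x | x = sem levels m5} by eexists.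
have F0 : agree (nwrites setup) (rwrites setup) m ms := frame setup m.
have E1 : ms = sem s1 m1 by rewrite h1 -semSq.
have E2 : ms = sem s2 m2 by rewrite h2 -semSq; exact: E1.
have E3 : ms = sem s3 m3 by rewrite h3 -semSq; exact: E2.
have E4 : ms = sem s4 m4 by rewrite h4 -semSq; exact: E3.
have E5 : ms = sem s5 m5 by rewrite h5 -semSq; exact: E4.
have E6 : ms = sem s6 m6 by rewrite h6 -semSq; exact: E5.
have F1 : agree (nwrites s1) (rwrites s1) m1 ms by rewrite E1; apply: frame.
have F2 : agree (nwrites s2) (rwrites s2) m2 ms by rewrite E2; apply: frame.
have F3 : agree (nwrites s3) (rwrites s3) m3 ms by rewrite E3; apply: frame.
have F4 : agree (nwrites s4) (rwrites s4) m4 ms by rewrite E4; apply: frame.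
have F5 : agree (nwrites s5) (rwrites s5) m5 ms by rewrite E5; apply: frame.
have F6 : agree (nwrites s6) (rwrites s6) m6 ms by rewrite E6; apply: frame.
clear E1 E2 E3 E4 E5 E6; rewrite /n /d /j /k /H /s /eps; clear n d j k H s eps.
clearbody ms.
have en1 : nmem m1 0 0 0 = nmem m 0 0 0 by rewrite -(proj1 F1) // (proj1 F0).
have ed1 : nmem m1 1 0 0 = nmem m 1 0 0 by rewrite -(proj1 F1) // (proj1 F0).
have en2 : nmem m2 0 0 0 = nmem m 0 0 0 by rewrite -(proj1 F2) // (proj1 F0).
have en3 : nmem m3 0 0 0 = nmem m 0 0 0 by rewrite -(proj1 F3) // (proj1 F0).
have en4 : nmem m4 0 0 0 = nmem m 0 0 0 by rewrite -(proj1 F4) // (proj1 F0).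
have ed4 : nmem m4 1 0 0 = nmem m 1 0 0 by rewrite -(proj1 F4) // (proj1 F0).
have [T1 T2 T3] := scalars_spec m2; rewrite -h3 en2 in T1 T2 T3.
have [J1 J2 J3] := root_search_spec m3; rewrite -h4 en3 in J1 J2 J3.
have [P1 P2 P3] := stepsize_spec m4; rewrite -h5 en4 ed4 in P1 P2 P3.
have [L1 L2] := levels_spec m5; rewrite -h6 in L1 L2.
have ek : rmem ms 5 0 0 = rmem m3 5 0 0 by rewrite (proj2 F3).
have eH : rmem ms 6 0 0 = rmem m3 6 0 0 by rewrite (proj2 F3).
have ej : nmem ms 10 0 0 = nmem m4 10 0 0 by rewrite (proj1 F4).
have es : rmem ms 8 0 0 = rmem m5 8 0 0 by rewrite (proj2 F5).
have ee : rmem ms 9 0 0 = rmem m5 9 0 0 by rewrite (proj2 F5).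
split; last split.
- split.
  + by move=> i hi; rewrite (proj2 F1) // h1 prod_with_e_spec.
  + move=> i hi; rewrite (proj2 F2) // h2 prod_with_e_spec ?en1 // ed1.
    by apply: eq_bigr => c _; rewrite -!(proj2 F1) // !(proj2 F0).
  + by rewrite ek T1; apply: eq_bigr => i _; rewrite -(proj2 F2).
  + by rewrite eH T2.
  + by rewrite (proj2 F3) // T3 ek T1.
- by rewrite ej ek eH; split.
- split.
  + by rewrite es P1 ej.
  + by rewrite ee P2 -P1 es.
  + by rewrite (proj2 F5) // P3 ee P2.
  + split; last by rewrite (proj2 F6).
    by rewrite (proj2 F6) // L2 (proj2 F5).
Qed.

Lemma setup_arrays m (ms := sem setup m) (n := nmem m 0 0 0) (d := nmem m 1 0 0) :
  [/\ forall i c, (i < n)%N -> (c < d)%N ->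
        rmem ms 11 i c = rmem m 1 i c / rmem ms 3 0 i - rmem m 0 0 c,
      forall i c, (i < n)%N -> (c < d)%N ->
        rmem ms 12 i c = rmem m 2 i c / rmem ms 4 0 i - rmem m 0 0 c,
      forall i j, (i < n)%N -> (j < n)%N ->
        rmem ms 13 i j = \sum_(c < d) rmem ms 11 i c * rmem ms 12 j c &
      forall i, (i < n)%N ->
        rmem ms 15 0 i = truncate (rmem ms 7 0 0) (rmem ms 3 0) i /\
        rmem ms 16 0 i = truncate (rmem ms 7 0 0) (rmem ms 4 0) i] /\
   forall i j, (i < n)%N -> (j < n)%N ->
        rmem ms 14 i j = growth_at ms i j ^+ (n * d) - (1 - nmem m 2 i j)%:R / 2.
Proof.
pose s10 := weights. pose s9 := select 4 16 ;; s10.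
pose s8 := select 3 15 ;; s9. pose s7 := gram ;; s8. pose s6 := recenter 2 4 12 ;; s7.
pose s5 := recenter 1 3 11 ;; s6. pose s4 := levels ;; s5. pose s3 := stepsize ;; s4.
pose s2 := root_search ;; s3. pose s1 := scalars ;; s2.
have [l0 g0] : {x | x = sem (prod_with_e 1 3) m} by eexists.
have [l1 g1] : {x | x = sem (prod_with_e 2 4) l0} by eexists.
have [l2 g2] : {x | x = sem scalars l1} by eexists.
have [l3 g3] : {x | x = sem root_search l2} by eexists.
have [l4 g4] : {x | x = sem stepsize l3} by eexists.
have [m5 h5] : {x | x = sem levels l4} by eexists.
have [m6 h6] : {x | x = sem (recenter 1 3 11) m5} by eexists.
have [m7 h7] : {x | x = sem (recenter 2 4 12) m6} by eexists.
have [m8 h8] : {x | x = sem gram m7} by eexists.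
have [m9 h9] : {x | x = sem (select 3 15) m8} by eexists.
have [m10 h10] : {x | x = sem (select 4 16) m9} by eexists.
have F0 : agree (nwrites setup) (rwrites setup) m ms := frame setup m.
have E0 : ms = sem (prod_with_e 2 4 ;; s1) l0 by rewrite g0 -semSq.
have E1 : ms = sem s1 l1 by rewrite g1 -semSq; exact: E0.
have E2 : ms = sem s2 l2 by rewrite g2 -semSq; exact: E1.
have E3 : ms = sem s3 l3 by rewrite g3 -semSq; exact: E2.
have E4 : ms = sem s4 l4 by rewrite g4 -semSq; exact: E3.
have E5 : ms = sem s5 m5 by rewrite h5 -semSq; exact: E4.
have E6 : ms = sem s6 m6 by rewrite h6 -semSq; exact: E5.
have E7 : ms = sem s7 m7 by rewrite h7 -semSq; exact: E6.
have E8 : ms = sem s8 m8 by rewrite h8 -semSq; exact: E7.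
have E9 : ms = sem s9 m9 by rewrite h9 -semSq; exact: E8.
have E10 : ms = sem s10 m10 by rewrite h10 -semSq; exact: E9.
have F5 : agree (nwrites s5) (rwrites s5) m5 ms by rewrite E5; apply: frame.
have F6 : agree (nwrites s6) (rwrites s6) m6 ms by rewrite E6; apply: frame.
have F7 : agree (nwrites s7) (rwrites s7) m7 ms by rewrite E7; apply: frame.
have F8 : agree (nwrites s8) (rwrites s8) m8 ms by rewrite E8; apply: frame.
have F9 : agree (nwrites s9) (rwrites s9) m9 ms by rewrite E9; apply: frame.
have F10 : agree (nwrites s10) (rwrites s10) m10 ms by rewrite E10; apply: frame.
have EW : forall i j, rmem ms 14 i j = rmem (sem weights m10) 14 i j by rewrite E10.
clear E0 E1 E2 E3 E4 E5 E6 E7 E8 E9 E10; rewrite /n /d; clear n d; clearbody ms.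
have en5 : nmem m5 0 0 0 = nmem m 0 0 0 by rewrite -(proj1 F5) // (proj1 F0).
have ed5 : nmem m5 1 0 0 = nmem m 1 0 0 by rewrite -(proj1 F5) // (proj1 F0).
have en6 : nmem m6 0 0 0 = nmem m 0 0 0 by rewrite -(proj1 F6) // (proj1 F0).
have ed6 : nmem m6 1 0 0 = nmem m 1 0 0 by rewrite -(proj1 F6) // (proj1 F0).
have en7 : nmem m7 0 0 0 = nmem m 0 0 0 by rewrite -(proj1 F7) // (proj1 F0).
have ed7 : nmem m7 1 0 0 = nmem m 1 0 0 by rewrite -(proj1 F7) // (proj1 F0).
have en8 : nmem m8 0 0 0 = nmem m 0 0 0 by rewrite -(proj1 F8) // (proj1 F0).
have en9 : nmem m9 0 0 0 = nmem m 0 0 0 by rewrite -(proj1 F9) // (proj1 F0).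
have en10 : nmem m10 0 0 0 = nmem m 0 0 0 by rewrite -(proj1 F10) // (proj1 F0).
have ed10 : nmem m10 1 0 0 = nmem m 1 0 0 by rewrite -(proj1 F10) // (proj1 F0).
split; first split.
- move=> i c hi hc; rewrite (proj2 F6) // h6 recenter_spec ?en5 ?ed5 //.
  by rewrite -!(proj2 F5) // (proj2 F0 1%N) // (proj2 F0 0%N).
- move=> i c hi hc; rewrite (proj2 F7) // h7 recenter_spec ?en6 ?ed6 //.
  by rewrite -!(proj2 F6) // (proj2 F0 2%N) // (proj2 F0 0%N).
- move=> i j hi hj; rewrite (proj2 F8) // h8 gram_spec ?en7 // ed7.
  by apply: eq_bigr => c _; rewrite -!(proj2 F7).
- move=> i hi; rewrite (proj2 F9 15%N) // h9 select_spec ?en8 //.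
  rewrite (proj2 F10 16%N) // h10 select_spec ?en9 //.
  by rewrite -!(proj2 F8) // -!(proj2 F9).
- move=> i j hi hj; rewrite EW weights_spec ?en10 // ed10.
  rewrite -(proj1 F10) // (proj1 F0) //.
  by rewrite /growth_at -!(proj2 F10).
Qed.

End Setup.

(** * From the SDP constraints to the biclique *)

Section Feasible.
Context (R : realType).

Lemma table_ord X (x0 : X) n m (f : 'I_n -> 'I_m -> X) (i : 'I_n) (j : 'I_m) :
  table x0 f i j = f i j.
Proof. by rewrite /table !valK. Qed.

(** When [a = <f, e>] and [b = <g, e>] are nonzero and [e] is a unit vector, the right side is
    [<f, g> / (a b) - 1]. For [f = g] with [<f, f> = a] this is [1 / a - 1]. *)
Lemma inner_centered d (f g e : nat -> R) (a b : R) :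
  \sum_(c < d) (f c / a - e c) * (g c / b - e c) =
  (\sum_(c < d) f c * g c) / (a * b) - (\sum_(c < d) f c * e c) / a
  - (\sum_(c < d) g c * e c) / b + \sum_(c < d) e c * e c.
Proof.
rewrite !mulr_suml -!sumrB -big_split; apply: eq_bigr => c _ /=.
by rewrite invfM; ring.
Qed.

Lemma truncate_neq0 (r : R) (a : nat -> R) i :
  truncate r a i != 0 -> 1 <= r * a i /\ truncate r a i = a i.
Proof. by rewrite /truncate; case: ifP; rewrite ?eqxx. Qed.

Lemma enorm_sqr d (x : 'rV[R]_d) : enorm x ^+ 2 = inner x x.
Proof.
rewrite /enorm sqr_sqrtr //; apply: sumr_ge0 => c _.
by rewrite -expr2 sqr_ge0.
Qed.

(** With [t = <x, e>], the squared distance from [x] to its projection on [e] is [t - t ^ 2]. *)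
Lemma inner_unit_itv d (x e : 'rV[R]_d) : enorm e ^+ 2 = 1 ->
  enorm x ^+ 2 = inner x e -> 0 <= inner x e <= 1.
Proof.
rewrite !enorm_sqr => he hx.
have x0 : 0 <= inner x e.
  by rewrite -hx; apply: sumr_ge0 => c _; rewrite -expr2 sqr_ge0.
rewrite x0 /= leNgt; apply/negP => h1.
have : 0 <= \sum_(c < d) (x 0 c - inner x e * e 0 c) ^+ 2.
  by apply: sumr_ge0 => c _; exact: sqr_ge0.
rewrite (eq_bigr (fun c => x 0 c * x 0 c - 2 * inner x e * (x 0 c * e 0 c) +
  inner x e ^+ 2 * (e 0 c * e 0 c))); last by move=> c _; ring.
rewrite big_split /= sumrB -!mulr_sumr.
have -> : \sum_(c < d) x 0 c * x 0 c = inner x e := hx.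
have -> : \sum_(c < d) e 0 c * e 0 c = 1 := he.
have -> : \sum_(c < d) x 0 c * e 0 c = inner x e by [].
rewrite expr2; nra.
Qed.

Lemma algorithm_correct n d (E : {set 'I_n * 'I_n}) (k : R)
    (e : 'rV[R]_d) (u v : 'I_n -> 'rV[R]_d) (D : R)
    (m' := sem algorithm (input E e u v)) :
  (3 <= n)%N -> 64 * 64 <= D -> 16 <= D * ln (ln 3) ->
  n%:R * (D * ln (ln n%:R) / ln n%:R) <= k -> mbb_sdp_feasible E k e u v ->
  balanced_biclique E (outputU n m') (outputV n m') /\
  n%:R `^ (1 / (D * (n%:R / k))) <= #|outputU n m'|%:R.
Proof.
move=> n3 D0 Dl hk [F1 F2 F3 F4 F5 F6 F7 F8 F9].
have n0 : (0 < n)%N by rewrite (leq_trans _ n3).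
(* A unit vector exists, so the dimension by which [eps] is divided is not 0. *)
have d0 : (0 < d)%N.
  rewrite lt0n; apply/eqP => dz; move: F1; rewrite enorm_sqr /inner.
  rewrite big1; first by move/eqP; rewrite eq_sym oner_eq0.
  by move=> [c hc]; exfalso; move: hc; rewrite dz.
have nm0 : nmem (input E e u v) 0 0 0 = n by [].
have nm1 : nmem (input E e u v) 1 0 0 = d by [].
have nm2 (i j : 'I_n) : nmem (input E e u v) 2 i j = ((i, j) \in E).
  by rewrite /= table_ord.
have nm3 i : nmem (input E e u v) 3 0 i = 0%N by [].
have nm12 : nmem (input E e u v) 12 0 0 = 0%N by [].
have rm0 (c : 'I_d) : rmem (input E e u v) 0 0 c = e 0 c.
  by rewrite /= (@table_ord _ _ _ _ _ (ord0 : 'I_1)).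
have rm1 (i : 'I_n) (c : 'I_d) : rmem (input E e u v) 1 i c = u i 0 c.
  by rewrite /= table_ord.
have rm2 (i : 'I_n) (c : 'I_d) : rmem (input E e u v) 2 i c = v i 0 c.
  by rewrite /= table_ord.
rewrite /m'; move: (input E e u v) nm0 nm1 nm2 nm3 nm12 rm0 rm1 rm2 => {m'} m
  nm0 nm1 nm2 nm3 nm12 rm0 rm1 rm2.
have [ms hms] : {x | x = sem setup m} by eexists.
have [md hmd] : {x | x = sem descent ms} by eexists.
have [mx hmx] : {x | x = sem extract md} by eexists.
have [mb hmb] : {x | x = sem balance mx} by eexists.
have -> : sem algorithm m = mb by rewrite hmb hmx hmd hms -3!semSq.
have [[A1 A2 A3 A4 A5] [[J1 J2 J3] [S1 S2 S3 [S4 S5]]]] := setup_scalars m.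
have [[X1 X2 X3 X4] X5] := setup_arrays m.
rewrite -hms nm0 ?nm1 in A1 A2 A3 A4 A5 J1 J2 J3 S1 S2 S3 S4 S5 X1 X2 X3 X4 X5.
have fs : agree (nwrites setup) (rwrites setup) m ms by rewrite hms; apply: frame.
have fd : agree (nwrites descent) (rwrites descent) ms md by rewrite hmd; apply: frame.
have fx : agree (nwrites extract) (rwrites extract) md mx by rewrite hmx; apply: frame.
have fb : agree (nwrites balance) (rwrites balance) mx mb by rewrite hmb; apply: frame.
have ns0 : nmem ms 0 0 0 = n by rewrite (proj1 fs).
have ns1 : nmem ms 1 0 0 = d by rewrite (proj1 fs).
have nd0 : nmem md 0 0 0 = n by rewrite (proj1 fd).
have nx0 : nmem mx 0 0 0 = n by rewrite (proj1 fx).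
have nd2 (i j : 'I_n) : nmem md 2 i j = ((i, j) \in E).
  by rewrite (proj1 fd) // (proj1 fs).
have nd3 (i : 'I_n) : nmem md 3 0 i = 0%N by rewrite (proj1 fd) // (proj1 fs).
have nd12 : nmem md 12 0 0 = 0%N by rewrite (proj1 fd) // (proj1 fs).
set a := rmem ms 3 0 in A1 A3 X1 X4; set b := rmem ms 4 0 in A2 X2 X4.
pose st i j := \sum_(c < d) rmem m 1 i c * rmem m 2 j c.
have aE (i : 'I_n) : a i = inner (u i) e.
  by rewrite A1 //; apply: eq_bigr => c _; rewrite rm0 rm1.
have bE (i : 'I_n) : b i = inner (v i) e.
  by rewrite A2 //; apply: eq_bigr => c _; rewrite rm0 rm2.
have stE (i j : 'I_n) : st i j = inner (u i) (v j).
  by apply: eq_bigr => c _; rewrite rm1 rm2.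
have a01 i : (i < n)%N -> 0 <= a i <= 1.
  by move=> hi; rewrite (aE (Ordinal hi)); apply: inner_unit_itv.
have b01 i : (i < n)%N -> 0 <= b i <= 1.
  by move=> hi; rewrite (bE (Ordinal hi)); apply: inner_unit_itv.
have suma : \sum_(i < n) a i = k by rewrite -F4; apply: eq_bigr => i _; rewrite aE.
have sumb : \sum_(i < n) b i = k by rewrite -F5; apply: eq_bigr => i _; rewrite bE.
have ek : rmem ms 5 0 0 = k by rewrite A3.
have kn : k <= n%:R.
  have -> : n%:R = \sum_(i < n) 1 :> R by rewrite sumr_const card_ord.
  by rewrite -suma; apply: ler_sum => i _; case/andP: (a01 i (ltn_ord i)).
rewrite ek in A5 J2 J3 S4.
have hH := harmonic_bounds R n0; rewrite -A4 in hH.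
rewrite S1 in S2.
have [k0 he hsr [S [hS1 hS2 hS3]]] := parameters n3 d0 D0 Dl hk kn hH J1 J2 J3.
rewrite -S1 -A5 in hsr; rewrite -S2 in he hS2 hS3; rewrite -A5 in hS3.
rewrite -S3 in hS2 hS3; rewrite -S1 in S2.
set s := rmem ms 8 0 0 in S1 S2 hsr; set eps := rmem ms 9 0 0 in S2 S3 he hS2 hS3.
set r := rmem ms 7 0 0 in A5 X4 hsr hS3; set beta := rmem ms 10 0 0 in S3 hS2 hS3.
have ee : \sum_(c < d) rmem m 0 0 c * rmem m 0 0 c = 1.
  rewrite -F1 enorm_sqr; apply: eq_bigr => c _; by rewrite rm0.
have r0 : 0 <= r by rewrite A5 divr_ge0 ?mulr_ge0 // ltW.
have eps0 : 0 <= eps <= 1 by case/andP: he => -> /ltW ->.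
have beta0 : 0 < beta by rewrite S3; clear - eps0; lra.
have P15 i : (i < n)%N -> rmem ms 15 0 i != 0 -> a i != 0 /\ (a i)^-1 <= r.
  move=> hi; case: (X4 i hi) => -> _ /truncate_neq0[h _].
  have ai : a i != 0 by apply: contraTneq h => ->; rewrite mulr0 ler10.
  have ap : 0 < a i by rewrite lt_def ai; case/andP: (a01 i hi).
  by split=> //; rewrite -[leLHS]mul1r ler_pdivrMr.
have P16 i : (i < n)%N -> rmem ms 16 0 i != 0 -> b i != 0 /\ (b i)^-1 <= r.
  move=> hi; case: (X4 i hi) => _ -> /truncate_neq0[h _].
  have bi : b i != 0 by apply: contraTneq h => ->; rewrite mulr0 ler10.
  have bp : 0 < b i by rewrite lt_def bi; case/andP: (b01 i hi).
  by split=> //; rewrite -[leLHS]mul1r ler_pdivrMr.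
have ME i j : (i < n)%N -> (j < n)%N -> a i != 0 -> b j != 0 ->
    rmem ms 13 i j = st i j / (a i * b j) - 1.
  move=> hi hj ai bj; rewrite X3 //.
  rewrite (eq_bigr (fun c : 'I_d => (rmem m 1 i c / a i - rmem m 0 0 c) *
    (rmem m 2 j c / b j - rmem m 0 0 c))); last by move=> c _; rewrite X1 ?X2.
  by rewrite inner_centered -A1 // -A2 // ee !divff //; rewrite addrNK.
have st0 i j : (i < n)%N -> (j < n)%N -> 0 <= st i j.
  by move=> hi hj; rewrite (stE (Ordinal hi) (Ordinal hj)).
have nx i : (i < n)%N -> rmem ms 15 0 i != 0 ->
    \sum_(c < d) rmem ms 11 i c * rmem ms 11 i c <= r.
  move=> hi /P15[//|ai hr].
  rewrite (eq_bigr (fun c : 'I_d => (rmem m 1 i c / a i - rmem m 0 0 c) *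
    (rmem m 1 i c / a i - rmem m 0 0 c))); last by move=> c _; rewrite X1.
  rewrite inner_centered -A1 // ee.
  have -> : \sum_(c < d) rmem m 1 i c * rmem m 1 i c = a i.
    rewrite (aE (Ordinal hi)) -F2 enorm_sqr; apply: eq_bigr => c _.
    by rewrite (rm1 (Ordinal hi)).
  by rewrite invfM mulrA divff // mul1r addrNK lerBlDr (le_trans hr) // lerDl.
have ny i : (i < n)%N -> rmem ms 16 0 i != 0 ->
    \sum_(c < d) rmem ms 12 i c * rmem ms 12 i c <= r.
  move=> hi /P16[//|bi hr].
  rewrite (eq_bigr (fun c : 'I_d => (rmem m 2 i c / b i - rmem m 0 0 c) *
    (rmem m 2 i c / b i - rmem m 0 0 c))); last by move=> c _; rewrite X2.
  rewrite inner_centered -A2 // ee.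
  have -> : \sum_(c < d) rmem m 2 i c * rmem m 2 i c = b i.
    rewrite (bE (Ordinal hi)) -F3 enorm_sqr; apply: eq_bigr => c _.
    by rewrite (rm2 (Ordinal hi)).
  by rewrite invfM mulrA divff // mul1r addrNK lerBlDr (le_trans hr) // lerDl.
have Mge i j : (i < n)%N -> (j < n)%N -> rmem ms 15 0 i != 0 -> rmem ms 16 0 j != 0 ->
    -1 <= rmem ms 13 i j.
  move=> hi hj /P15[//|ai _] /P16[//|bj _].
  rewrite ME // lerBrDr addNr divr_ge0 ?st0 // mulr_ge0 //.
    by case/andP: (a01 i hi).
  by case/andP: (b01 j hj).
have ft0 (f : nat -> R) i : 0 <= f i -> 0 <= truncate r f i.
  by rewrite /truncate; case: ifP.
have p0 i : (i < n)%N -> 0 <= rmem ms 15 0 i.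
  by move=> hi; case: (X4 i hi) => -> _; apply: ft0; case/andP: (a01 i hi).
have q0 i : (i < n)%N -> 0 <= rmem ms 16 0 i.
  by move=> hi; case: (X4 i hi) => _ ->; apply: ft0; case/andP: (b01 i hi).
have hPhi : 0 < Phi n (rmem ms 14) (rmem ms 18 0 0) (rmem ms 15 0) (rmem ms 16 0).
  have := @potential_init R n (n * d) a b st (rmem ms 13)
    (fun i j => (1 - nmem m 2 i j)%N) k eps n0 k0 eps0 a01 b01 st0 suma sumb.
  rewrite -A5 -S3 S4 => h.
  rewrite (@eq_Phi R n _ (fun i j => ((1 + eps * rmem ms 13 i j) / beta) ^+ (n * d) -
    (1 - nmem m 2 i j)%:R / 2) _ _ _ (truncate r a) (truncate r b)).
  - apply: h => //.
    + move=> i hi; rewrite (aE (Ordinal hi)) -F8; apply: eq_bigr => j _.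
      exact: (stE (Ordinal hi)).
    + move=> j hj; rewrite (bE (Ordinal hj)) -F9; apply: eq_bigr => i _.
      exact: (stE i (Ordinal hj)).
    + by move=> i j _ _; rewrite leq_subr.
  - by move=> i j hi hj; rewrite X5.
  - by move=> i hi; case: (X4 i hi).
  - by move=> i hi; case: (X4 i hi).
have L0 : 0 < rmem ms 18 0 0 by rewrite S4 divr_gt0.
have := @descent_spec R ms; rewrite ns0 ns1 -hmd => /(_ d0 S2 S3 he r0 hsr (ltW L0) X3
  p0 q0 nx ny Mge hPhi) [G1 G2 G3 G4 G5].
rewrite -/eps -/beta -/r in G1 G2.
rewrite S5 in G1; rewrite S4 in G2.
pose p (i : 'I_n) := rmem md 15 0 i; pose q (i : 'I_n) := rmem md 16 0 i.
set K := rmem md 17 0 0 in G1; set L := rmem md 18 0 0 in G2 G5.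
have pp i : 0 <= p i by case: (G4 i (ltn_ord i)).
have qq i : 0 <= q i by case: (G4 i (ltn_ord i)) => _ [].
have e1 : 0 < 1 - eps by rewrite subr_gt0; case/andP: he.
have K0 : 0 < K by rewrite G1 mulr_gt0 // exprn_gt0 // divr_gt0.
have er0 : 0 < 1 + eps * r by rewrite ltr_wpDr // mulr_ge0 //; case/andP: he.
have Lp : 0 < L by rewrite G2 mulr_gt0 ?divr_gt0 // exprn_gt0 // divr_gt0.
pose loss (i : 'I_n) := \sum_j (1 - ((i, j) \in E))%:R * q j.
have hAB : K * (\sum_i p i * loss i) + L * (\sum_i p i * p i + \sum_i q i * q i) <
    (\sum_i p i) * (\sum_i q i).
  (* On a non-edge the SDP forces [M i j = -1], so [1 / 2] divided by the accumulated growth is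
     exactly the final [K]. Pairs of weight 0 are set apart, since their growth may vanish. *)
  have hW (i j : 'I_n) : rmem md 14 i j * (p i * q j) =
      p i * q j - K * (p i * ((1 - ((i, j) \in E))%:R * q j)).
    have [->|pi] := eqVneq (p i) 0; first by rewrite !(mul0r, mulr0) subr0.
    have [->|qj] := eqVneq (q j) 0; first by rewrite !(mul0r, mulr0) subr0.
    have [_ [_ [/(_ pi) pi0 _]]] := G4 i (ltn_ord i).
    have [_ [_ [_ /(_ qj) qj0]]] := G4 j (ltn_ord j).
    have [//|ai _] := P15 i _ pi0; have [//|bj _] := P16 j _ qj0.
    have hM := Mge i j (ltn_ord i) (ltn_ord j) pi0 qj0.
    have fpos : 0 < growth_at ms i j.
      rewrite /growth_at -/eps -/beta divr_gt0 //.
      exact: one_add_gt0.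
    rewrite G3 // X5 // nm2 mulrBl divff ?gt_eqF ?exprn_gt0 //.
    case: (boolP ((i, j) \in E)) => hE /=.
      by rewrite subnn !mul0r !mulr0 !subr0 mul1r.
    have hM1 : rmem ms 13 i j = -1.
      by rewrite ME // stE F6 // mul0r sub0r.
    have -> : growth_at ms i j = (beta / (1 - eps))^-1.
      by rewrite /growth_at -/eps -/beta hM1 mulrN1 invf_div.
    by rewrite subn0 G1 exprVn invrK; ring.
  rewrite -subr_gt0; apply: lt_le_trans G5 _; rewrite /Phi.
  rewrite (eq_bigr (fun i : 'I_n => p i * \sum_j q j - K * (p i * loss i))); last first.
    move=> i _; rewrite (eq_bigr _ (fun j _ => hW i j)) sumrB -!mulr_sumr.
    by [].
  rewrite sumrB -!mulr_sumr -mulr_suml le_eqVlt; apply/orP; left; apply/eqP.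
  by rewrite /p /q; ring.
rewrite -G1 in hS2; rewrite -G2 in hS3.
have [hG hcommon] := biclique_bound pp qq K0 Lp hAB hS2 hS3.
have [SS [Y1 Y2 Y3 Y4 Y5]] := extract_spec nd0 nd2 nd3 nd12.
rewrite -hmx in Y1 Y2 Y3.
have egood : good n md = [set i | K * loss i <= 2 * \sum_j q j].
  apply/setP => i; rewrite !inE /bad /loss.
  by rewrite (eq_bigr (fun j : 'I_n => (1 - ((i, j) \in E))%:R * q j)) // => j _; rewrite nd2.
have hSS : (S <= #|SS|)%N by apply: Y5; rewrite egood.
have [T' [Z1 Z2 Z3]] := balance_spec nx0 Y2 (leq_trans (eq_leq Y3) Y4).
rewrite -hmb in Z1; rewrite Y3 in Z3.
have eU : outputU n mb = SS.
  apply/setP => i; rewrite inE (proj1 fb) // Y1; by case: (i \in SS).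
have eV : outputV n mb = T'.
  apply/setP => i; rewrite inE Z1; by case: (i \in T').
rewrite eU eV; split; last first.
  by apply: le_trans hS1 _; rewrite ler_nat.
split=> [|i j hi hj]; first by rewrite Z3.
by move/(fintype.subsetP Z2): hj; rewrite inE => /forall_inP/(_ i hi).
Qed.

End Feasible.

Local Open Scope classical_set_scope.

(** No sample is drawn, so success is certain and the error can be 0. *)
Theorem theorem3 (R : realType) :
  exists (D : R) (p : cmd) (C : nat) (err : nat -> R),
    [/\ 1 < D,
        runs_in_time R p C,
        err @ \oo --> (0 : R) &
        forall (n d : nat) (E : {set 'I_n * 'I_n}) (k : R)
               (e : 'rV[R]_d) (u v : 'I_n -> 'rV[R]_d),
          let t := n%:R / k in
          let T := time_bound C n d in
          (3 <= n)%N ->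
          n%:R * (D * ln (ln n%:R) / ln n%:R) <= k ->
          mbb_sdp_feasible E k e u v ->
          let found : set (T.-tuple (measurableTypeR R)) := [set g |
            let m := gauss_run p (input E e u v) g in
            balanced_biclique E (outputU n m) (outputV n m) /\
            n%:R `^ (1 / (D * t)) <= #|outputU n m|%:R] in
          ((1 - err n)%:E <= gauss_law R T found)%E].
Proof.
have l3 := ln_ln3_gt0 R.
have [C hC] := run_compile R wf_algorithm.
(* The second summand makes [D * ln (ln n)] at least 16 for all [n >= 3]; the first comes from the
   growth of [K]. *)
pose D : R := 64 * 64 + 16 / ln (ln 3).
have D0 : 64 * 64 <= D by rewrite lerDl divr_ge0 // ltW.
exists D, (compile algorithm), C, (fun=> 0); split.
- by apply: lt_le_trans D0; lra.
- by move=> n d E e u v g; case: (hC (input E e u v) g).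
- exact: cvg_cst.
- move=> n d E k e u v; cbv zeta => n3 hk hf; set found := (X in gauss_law _ _ X).
  suff -> : found = setT by rewrite probability_setT subr0.
  apply/seteqP; split=> // g _; rewrite /found /gauss_run /=.
  have [_ ->] := hC (input E e u v) (fun s => nth 0 g s).
  apply: algorithm_correct => //.
  by rewrite mulrDl divfK ?gt_eqF // lerDr mulr_ge0 // ltW.
Qed.
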